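(* Let $p\in[1,2]$, $\alpha\in(0,1)$, and let ${\bm{A}}_1,\dots,{\bm{A}}_m$ be real $n\times n$ matrices such that (1) $\|{\bm{A}}_i\|_p\le 1$ for all $i$, and (2) $\|{\bm{A}}_{i+1}-{\bm{A}}_i\|_p\le\alpha$ for all $i\le m-1$. Given matrix-vector multiplication query access to the matrices, a failure rate $\delta>0$ and an error bound $\varepsilon>0$, there is a (randomized) algorithm that outputs a sequence of estimates $t_1,\dots,t_m$ such that for each $i\in[m]$, $$|t_i-\operatorname{tr}({\bm{A}}_i)|\le\varepsilon\quad\text{with probability at least }1-\delta.$$ The algorithm uses a total of $$O\!\left((m\alpha+1)\log^{1+p}(1/\alpha)\left(\frac{\sqrt{\log(1/(\alpha\delta))}}{\varepsilon}\right)^p+m\log(1/(\alpha\delta))\right)$$ matrix-vector multiplication queries to ${\bm{A}}_1,\dots,{\bm{A}}_m$.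
   Context: $\|\cdot\|_p$ denotes the Schatten-$p$ norm (the $\ell_p$ norm of the singular values). The algorithm accesses each matrix only through matrix-vector products ${\bm{A}}_jx$; the estimate $t_i$ is produced using queries to ${\bm{A}}_1,\dots,{\bm{A}}_i$ only, and the query complexity is the total number of products.
   Formalization: Each logarithm in the query bound is read as max(1, log); with the plain logarithm the bound fails as α tends to 1 (already for m = 1) and is undefined when αδ > 1. For α ≤ 1/2 and δ < 1 the two bounds agree up to a constant factor. *)

(* Defs.v *)
From HB Require Import structures.
From mathcomp Require Import all_boot all_order all_algebra.
From mathcomp Require Import complex.
From mathcomp Require Import all_classical all_reals all_analysis.
Set Implicit Arguments.
Unset Strict Implicit.
Unset Printing Implicit Defensive.
Import Order.TTheory GRing.Theory Num.Theory.
Local Open Scope ring_scope.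

(* Singular values of A, with multiplicity: the square roots of the eigenvalues
   of the Gram matrix A^T A.  The Gram matrix is viewed over R[i] because
   [spectral_diag] is only available over a closed field; it is real symmetric
   and positive semidefinite, so its eigenvalues are real and nonnegative. *)
Definition singular_value (R : realType) (n : nat) (A : 'M[R]_n) (i : 'I_n) : R :=
  Num.sqrt
    (complex.Re (spectral_diag (map_mx (real_complex R) (A^T *m A)) 0 i)).

Definition schatten_norm (R : realType) (n : nat) (p : R) (A : 'M[R]_n) : R :=
  (\sum_(i < n) singular_value A i `^ p) `^ p^-1.

(* Deterministic adaptive algorithm accessing matrices A_0, ..., A_(m-1) through
   matrix-vector products and emitting estimates t_0, ..., t_(m-1) in order.
   The index i is the number of estimates already emitted, so a term of type
   [online_alg R n m i] with i < m is currently computing t_i, and may query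
   A_j only if j <= i.  [Halt] lives at index m: starting from index 0, exactly m
   estimates are emitted.  The later queries and estimates depend on the
   matrices only through the answers fed to the continuation of [Query]. *)
Inductive online_alg (R : realType) (n m : nat) : nat -> Type :=
| Halt : online_alg R n m m
| Query (i : nat) (j : 'I_m) (x : 'cV[R]_n) :
    (j <= i)%N -> ('cV[R]_n -> online_alg R n m i) -> online_alg R n m i
| Emit (i : nat) : R -> online_alg R n m i.+1 -> online_alg R n m i.

Fixpoint outputs (R : realType) (n m : nat) (A : 'I_m -> 'M[R]_n)
    (i : nat) (a : online_alg R n m i) : seq R :=
  match a with
  | Halt => [::]
  | Query _ j x _ k => outputs A (k (A j *m x))
  | Emit _ t a' => t :: outputs A a'
  end.

Fixpoint num_queries (R : realType) (n m : nat) (A : 'I_m -> 'M[R]_n)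
    (i : nat) (a : online_alg R n m i) : nat :=
  match a with
  | Halt => 0
  | Query _ j x _ k => (num_queries A (k (A j *m x))).+1
  | Emit _ _ a' => num_queries A a'
  end.

(* A randomized algorithm is a random deterministic one, w being the seed. *)
Definition estimate (R : realType) (n m : nat) (T : Type)
    (alg : T -> online_alg R n m 0) (A : 'I_m -> 'M[R]_n) (i : 'I_m) (w : T) : R :=
  nth 0 (outputs A (alg w)) i.

(* Usual convention for logarithms in complexity bounds: truncated below at 1.
   With the plain ln, the first term of the bound would vanish as alpha tends to
   1, where the claim fails (already for m = 1), and ln (1 / (alpha * delta))
   could be negative when delta > 1.  For alpha bounded away from 1 and
   delta < 1, the two versions agree up to a constant factor. *)
Definition Log (R : realType) (x : R) : R := Num.max 1 (ln x).

Definition query_bound (R : realType) (m : nat) (p alpha delta eps : R) : R :=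
  (m%:R * alpha + 1) * Log (1 / alpha) `^ (1 + p)
    * (Num.sqrt (Log (1 / (alpha * delta))) / eps) `^ p
  + m%:R * Log (1 / (alpha * delta)).

(* Main.v *)
Require Import Defs.
From HB Require Import structures.
From mathcomp Require Import all_boot all_order all_algebra.
From mathcomp Require Import complex.
From mathcomp Require Import all_classical all_reals all_analysis.
From mathcomp Require Import ring lra zify.
Set Implicit Arguments.
Unset Strict Implicit.
Unset Printing Implicit Defensive.
Import Order.TTheory GRing.Theory Num.Theory.
Local Open Scope classical_set_scope.
Local Open Scope ring_scope.

(** The trace of [A_i] is written as a sum of at most [L + 1] traces, where
    [2 ^ L] is about [1 / alpha]: at time [i], with [v] the 2-adic valuation of
    [i] capped at [L], only the increment [A_i - A_(i - 2^v)] is estimated (or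
    [A_i] itself if [v = L]).  Its Schatten norm is at most [2^v alpha], so the
    rare estimates are the expensive ones and each level costs about the same in
    total.  A union bound along the chain gives the failure probability, hence
    the seeds may be shared between all times.

    A single matrix [B] with Schatten norm at most [b] is handled as follows.
    Random sign vectors [x] are multiplied by [B] one after the other, and the
    image [B x] is projected out: [D] denotes the orthogonal projector on the
    complement of the span of the images.  With [K = B^T D B], [F = tr K] and
    [T = tr K^2], the residual energy [F = |D B|_F^2] decreases by at least
    [T / (4 F)] with probability at least [1 / 6] in each round, whatever the
    past.  Since [K] is dominated by [B^T B], the diagonal of [K] in an
    eigenbasis of [B^T B] is dominated by the squared singular values of [B],
    so [F <= T / t + t^(1 - p/2) b^p] for all [t > 0]: a large energy forces a
    large decrease, and [g] successful rounds bring [F] down to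
    [O(b^2 g^(1 - 2/p))].  The trace of [(1 - D) B] is then computed exactly and
    that of [D B] by sign vectors [x^T D B x], averaged in groups; any point
    close to more than half of the group averages is a good estimate with
    overwhelming probability. *)

(** * Convexity inequalities for the real power function *)

(** For [p > 1] this is Young's inequality for [x] and [y^(p - 1)] with the conjugate exponents [p]
    and [p / (p - 1)]. *)
Lemma powR_ge_tangent (R : realType) (p x y : R) :
  1 <= p -> 0 <= x -> 0 < y -> y `^ p + p * y `^ (p - 1) * (x - y) <= x `^ p.
Proof.
move=> p1 x0 y0; have p0 : 0 < p by lra.
have yy : y * y `^ (p - 1) = y `^ p by rewrite mulr_powRB1// ltW.
have [->|pn1] := eqVneq p 1.
  by rewrite subrr powRr0 !powRr1 ?(ltW y0)//; lra.
have p1' : 0 < p - 1 by rewrite subr_gt0 lt_neqAle eq_sym pn1.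
have q0 : 0 < p / (p - 1) by rewrite divr_gt0.
have := @conjugate_powR R x (y `^ (p - 1)) p (p / (p - 1)) x0 (powR_ge0 _ _) p0 q0.
rewrite -powRrM mulrCA divff ?gt_eqF// mulr1 => /(_ _)/wrap[].
  by field; rewrite !gt_eqF.
rewrite -(ler_pM2l p0) mulrDr !mulrA.
have -> : p * x `^ p / p = x `^ p by field; rewrite gt_eqF.
have -> : p * y `^ p / (p / (p - 1)) = (p - 1) * y `^ p by field; rewrite !gt_eqF.
by move: yy; nra.
Qed.

(** With [W] the total weight, the tangent lines at [y] sum to [y^p + (p - 1) y^p (1 - W)], so a
    total mass below one does no harm. *)
Lemma powR_jensen (R : realType) (I : finType) (p : R) (w s : I -> R) :
  1 <= p -> (forall i, 0 <= w i) -> (forall i, 0 <= s i) -> \sum_i w i <= 1 ->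
  (\sum_i w i * s i) `^ p <= \sum_i w i * s i `^ p.
Proof.
move=> p1 w0 s0 w1; set y := \sum_i w i * s i.
have : 0 <= y by apply: sumr_ge0 => i _; rewrite mulr_ge0.
rewrite le_eqVlt => /predU1P[<-|y0].
  rewrite powR0; last by rewrite gt_eqF// (lt_le_trans _ p1).
  by apply: sumr_ge0 => i _; rewrite mulr_ge0// powR_ge0.
have : \sum_i w i * (y `^ p + p * y `^ (p - 1) * (s i - y)) <= \sum_i w i * s i `^ p.
  by apply: ler_sum => i _; rewrite ler_wpM2l// powR_ge_tangent.
apply: le_trans.
have -> : \sum_i w i * (y `^ p + p * y `^ (p - 1) * (s i - y)) =
  (\sum_i w i) * (y `^ p - p * y `^ (p - 1) * y) + p * y `^ (p - 1) * y.
  pose c := p * y `^ (p - 1).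
  transitivity (\sum_i (w i * (y `^ p - c * y) + c * (w i * s i))).
    by apply: eq_bigr => i _; rewrite /c; ring.
  by rewrite big_split/= -mulr_suml -mulr_sumr.
have -> : p * y `^ (p - 1) * y = p * y `^ p.
  by rewrite -mulrA [_ * y]mulrC mulr_powRB1 ?(ltW y0)//; lra.
have : 0 <= (p - 1) * y `^ p * (1 - \sum_i w i).
  by rewrite !mulr_ge0 ?powR_ge0 ?subr_ge0.
set u := y `^ p; set W := \sum_i _; nra.
Qed.

Lemma powR_div (R : realType) (p x c : R) :
  0 <= x -> 0 < c -> (x / c) `^ p = x `^ p / c `^ p.
Proof.
move=> x0 c0; rewrite powRM ?invr_ge0 ?(ltW c0)//; congr (_ * _).
have cp0 := powR_gt0 p c0; apply: (mulIf (lt0r_neq0 cp0)).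
by rewrite -powRM ?invr_ge0 ?(ltW c0)// !mulVf ?gt_eqF// powR1.
Qed.

(** [(x + y) / (a + b)] is the convex combination of [x / a] and [y / b] with weights [a / (a + b)]
    and [b / (a + b)]; Jensen's inequality is applied at each index and summed. *)
Lemma powR_minkowski (R : realType) (I : finType) (p a b : R) (s x y : I -> R) :
  1 <= p -> 0 < a -> 0 < b -> (forall i, 0 <= x i) -> (forall i, 0 <= y i) ->
  (forall i, 0 <= s i <= x i + y i) ->
  \sum_i x i `^ p <= a `^ p -> \sum_i y i `^ p <= b `^ p ->
  \sum_i s i `^ p <= (a + b) `^ p.
Proof.
move=> p1 a0 b0 x0 y0 sxy hx hy; have p0 : 0 <= p by lra.
pose w (c : bool) := (if c then a else b) / (a + b).
pose u i (c : bool) := if c then x i / a else y i / b.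
have ab0 : 0 < a + b by rewrite addr_gt0.
have w0 c : 0 <= w c by case: c; rewrite /w divr_ge0// ltW.
have u0 i c : 0 <= u i c by case: c; rewrite /u divr_ge0 ?x0 ?y0// ltW.
have w1 : \sum_c w c <= 1.
  by rewrite big_bool/= /w -mulrDl divff// gt_eqF.
have step i : s i `^ p <=
    (a + b) `^ p * (a / (a + b) * (x i `^ p / a `^ p) + b / (a + b) * (y i `^ p / b `^ p)).
  have -> : x i `^ p / a `^ p = u i true `^ p.
    by rewrite /u powR_div.
  have -> : y i `^ p / b `^ p = u i false `^ p.
    by rewrite /u powR_div.
  have := powR_jensen p1 w0 (u0 i) w1; rewrite !big_bool/= => h.
  apply: le_trans (ler_wpM2l (powR_ge0 (a + b) p) h).
  rewrite -powRM ?(ltW ab0)//; last first.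
    by rewrite addr_ge0// mulr_ge0 ?w0//; [exact: (u0 i true)|exact: (u0 i false)].
  have -> : (a + b) * (w true * u i true + w false * u i false) = x i + y i.
    by rewrite /w /u; field; rewrite !gt_eqF.
  by apply: ge0_ler_powR; rewrite ?nnegrE ?addr_ge0 ?x0 ?y0//; case/andP: (sxy i).
apply: le_trans (ler_sum _ (fun i _ => step i)) _.
rewrite -mulr_sumr ler_piMr ?powR_ge0// big_split/= -!mulr_sumr -!mulr_suml.
have ha : (\sum_i x i `^ p) / a `^ p <= 1 by rewrite ler_pdivrMr ?mul1r ?powR_gt0.
have hb : (\sum_i y i `^ p) / b `^ p <= 1 by rewrite ler_pdivrMr ?mul1r ?powR_gt0.
have : a / (a + b) + b / (a + b) = 1 by rewrite -mulrDl divff// gt_eqF.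
move=> <-; apply: lerD.
  by rewrite ler_piMr// (w0 true).
by rewrite ler_piMr// (w0 false).
Qed.

(** * Gram matrices and the singular value decomposition *)

Section SingularValues.
Local Open Scope sesquilinear_scope.
Local Open Scope complex_scope.
Variable R : realType.
Local Notation C := R[i].

Local Notation toC := (map_mx (real_complex R)).

Definition colsq (m n : nat) (Z : 'M[C]_(m, n)) (i : 'I_n) : R :=
  \sum_j Normc.normc (Z j i) ^+ 2.

Lemma colsq_ge0 (m n : nat) (Z : 'M[C]_(m, n)) i : 0 <= colsq Z i.
Proof. by apply: sumr_ge0 => j _; rewrite sqr_ge0. Qed.

Lemma adjmxM (m n k : nat) (A : 'M[C]_(m, n)) (B : 'M[C]_(n, k)) :
  (A *m B)^t* = B^t* *m A^t*.
Proof. by rewrite trmx_mul map_mxM. Qed.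

Lemma adjmx_real (m n : nat) (A : 'M[R]_(m, n)) : (toC A)^t* = toC A^T.
Proof.
apply/matrixP => i j; rewrite !mxE; apply: conj_Creal.
by apply/complex_realP; exists (A j i).
Qed.

Lemma sqr_normcE (z : C) : Num.conj z * z = (Normc.normc z ^+ 2)%:C.
Proof. by rewrite mulrC -normCK rmorphXn. Qed.

Lemma sqr_normc_real (t : R) : Normc.normc t%:C ^+ 2 = t ^+ 2.
Proof. by rewrite /= expr0n/= addr0 sqr_sqrtr// sqr_ge0. Qed.

Lemma gram_colsq (m n : nat) (Z : 'M[C]_(m, n)) i :
  (Z^t* *m Z) i i = (colsq Z i)%:C.
Proof.
by rewrite !mxE rmorph_sum/=; apply: eq_bigr => j _; rewrite !mxE sqr_normcE.
Qed.

(** Pythagoras for the orthogonal pieces [P Z] and [(1 - P) Z]. *)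
Lemma colsq_proj_le (m n : nat) (P : 'M[C]_m) (Z : 'M[C]_(m, n)) i :
  P^t* = P -> P *m P = P -> colsq (P *m Z) i <= colsq Z i.
Proof.
move=> Padj PP.
have adjB : (1%:M - P)^t* = 1%:M - P.
  by rewrite linearB/= map_mxB trmx1 map_mx1 Padj.
suff : colsq Z i = colsq (P *m Z) i + colsq ((1%:M - P) *m Z) i.
  by move=> ->; rewrite lerDl colsq_ge0.
apply: (@complexI R); rewrite rmorphD/= -!gram_colsq !adjmxM Padj adjB.
have BB : (1%:M - P) *m (1%:M - P) = 1%:M - P.
  by rewrite mulmxBr mulmx1 mulmxBl mul1mx PP subrr subr0.
rewrite !mulmxA -(mulmxA _ P P) PP -(mulmxA _ (1%:M - P) (1%:M - P)) BB.
have -> : Z^t* *m Z = Z^t* *m P *m Z + Z^t* *m (1%:M - P) *m Z.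
  by rewrite -mulmxDl -mulmxDr addrC subrK mulmx1.
by rewrite mxE.
Qed.

Lemma colsq_isometry (m n k : nat) (U : 'M[C]_(m, k)) (Z : 'M[C]_(m, n)) i :
  U *m U^t* = 1%:M -> colsq (U^t* *m Z) i = colsq Z i.
Proof.
move=> UU; apply: (@complexI R); rewrite -!gram_colsq adjmxM trmxCK.
by rewrite !mulmxA -(mulmxA _ U) UU mulmx1.
Qed.

Lemma colsq_unitary (n : nat) (V : 'M[C]_n) i : V^t* *m V = 1%:M -> colsq V i = 1.
Proof.
by move=> VV; apply: (@complexI R); rewrite -gram_colsq VV mxE eqxx.
Qed.

(** [spectralmx] holds the eigenvectors as rows; its adjoint has the right singular vectors of [A]
    as columns. *)
Definition eigbasis (n : nat) (A : 'M[R]_n) : 'M[C]_n :=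
  (spectralmx (toC (A^T *m A)))^t*.

Lemma eigbasis_adjmul (n : nat) (A : 'M[R]_n) :
  (eigbasis A)^t* *m eigbasis A = 1%:M.
Proof. by rewrite trmxCK; apply/unitarymxP/spectral_unitarymx. Qed.

Lemma eigbasis_muladj (n : nat) (A : 'M[R]_n) :
  eigbasis A *m (eigbasis A)^t* = 1%:M.
Proof. by apply: mulmx1C; exact: eigbasis_adjmul. Qed.

Lemma eigbasis_diag (n : nat) (A : 'M[R]_n) :
  (toC A *m eigbasis A)^t* *m (toC A *m eigbasis A) =
  diag_mx (spectral_diag (toC (A^T *m A))).
Proof.
set M := toC (A^T *m A).
have Mnorm : M \is normalmx.
  by apply/normalmxP; rewrite adjmx_real trmx_mul trmxK.
have /orthomx_spectralP := Mnorm.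
rewrite invmx_unitary ?spectral_unitarymx// => defM.
rewrite adjmxM adjmx_real !mulmxA -(mulmxA _ (toC A^T)) -map_mxM -/M.
rewrite {1}defM trmxCK.
rewrite !mulmxA (unitarymxP (spectral_unitarymx _)) mul1mx -mulmxA.
by rewrite (unitarymxP (spectral_unitarymx _)) mulmx1.
Qed.

Lemma singular_value_ge0 (n : nat) (A : 'M[R]_n) i : 0 <= singular_value A i.
Proof. exact: sqrtr_ge0. Qed.

Lemma sqr_singular_value (n : nat) (A : 'M[R]_n) i :
  singular_value A i ^+ 2 = colsq (toC A *m eigbasis A) i.
Proof.
have := congr1 (fun M : 'M[C]_n => M i i) (eigbasis_diag A).
rewrite gram_colsq mxE eqxx mulr1n => e; rewrite /singular_value -e /=.
by rewrite sqr_sqrtr// colsq_ge0.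
Qed.

(** Here [a] is the diagonal of [K] in an eigenbasis [v] of [A^T A]:
    [a i = |D A v_i|^2 <= |A v_i|^2]. The trace does not depend on the basis, and the squared
    diagonal entries are part of the squared Frobenius norm [tr (K K)]. *)
Lemma compressed_gram_diag (n : nat) (A D : 'M[R]_n) :
  D^T = D -> D *m D = D -> let K := A^T *m D *m A in
  exists a : 'I_n -> R,
    [/\ forall i, 0 <= a i <= singular_value A i ^+ 2,
        \sum_i a i = \tr K & \sum_i a i ^+ 2 <= \tr (K *m K)].
Proof.
move=> Dsym DD K.
have KE : toC K = toC A^T *m toC D *m toC A by rewrite !map_mxM.
have Ksym : K^T = K by rewrite /K !trmx_mul trmxK Dsym mulmxA.
clearbody K.
move: (eigbasis A) (eigbasis_muladj A) (sqr_singular_value A) => V VV svE.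
pose Z := toC D *m (toC A *m V).
have ZZ : Z^t* *m Z = V^t* *m toC K *m V.
  rewrite !adjmxM !adjmx_real Dsym KE mulmxA -[in LHS](mulmxA _ (toC D) (toC D)).
  by rewrite -map_mxM DD !mulmxA.
have Zle i : colsq Z i <= singular_value A i ^+ 2.
  rewrite svE colsq_proj_le//; first by rewrite adjmx_real Dsym.
  by rewrite -map_mxM DD.
move: Z ZZ Zle => Z ZZ Zle; exists (colsq Z); split.
- by move=> i; rewrite colsq_ge0 Zle.
- apply: (@complexI R); rewrite rmorph_sum/=.
  transitivity (\tr (Z^t* *m Z)).
    by apply: eq_bigr => i _; rewrite gram_colsq.
  by rewrite ZZ mxtrace_mulC mulmxA VV mul1mx trace_map_mx.
- move: (Z^t* *m Z) ZZ (gram_colsq Z) => Y YE Yii.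
  have YY : \tr (Y^t* *m Y) = (\tr (K *m K))%:C.
    rewrite YE !adjmxM trmxCK adjmx_real Ksym -!mulmxA (mulmxA V) VV mul1mx.
    by rewrite mxtrace_mulC -!mulmxA VV mulmx1 -map_mxM trace_map_mx.
  rewrite -lecR -YY rmorph_sum/= /mxtrace; apply: ler_sum => i _.
  rewrite gram_colsq lecR /(colsq Y) (bigD1 i)// Yii sqr_normc_real lerDl.
  by apply: sumr_ge0 => j _; exact: sqr_ge0.
Qed.

(** [Q] is [A V] times the pseudo-inverse of the singular values. Its columns at zero singular
    values vanish, so it is a partial isometry only; hence the inequalities in the last two
    claims. *)
Lemma svd (n : nat) (A : 'M[R]_n) :
  let sg := diag_mx (\row_i (singular_value A i)%:C) in
  exists Q V : 'M[C]_n,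
    [/\ V *m V^t* = 1%:M, toC A *m V = Q *m sg, Q^t* *m toC A *m V = sg,
        forall i, colsq Q i <= 1 &
        forall (m : nat) (Z : 'M[C]_(n, m)) i, colsq (Q^t* *m Z) i <= colsq Z i].
Proof.
move=> sg; have VV := eigbasis_muladj A; pose W := toC A *m eigbasis A.
pose isg := diag_mx (\row_i ((singular_value A i)^-1)%:C).
pose e := diag_mx (\row_i ((singular_value A i != 0)%:R : C)).
have WW : W^t* *m W = sg *m sg.
  rewrite eigbasis_diag; apply/matrixP => i j; rewrite mul_diag_mx !mxE.
  have [_|_] := eqVneq i j; last by rewrite mulr0.
  have := congr1 (fun M : 'M[C]_n => M i i) (eigbasis_diag A).
  rewrite gram_colsq mxE eqxx mulr1n => <-.
  by rewrite -sqr_singular_value !mulr1n -rmorphM.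
have isgsg : isg *m sg = e.
  apply/matrixP => i j; rewrite mul_diag_mx !mxE.
  have [_|_] := eqVneq i j; last by rewrite mulr0.
  rewrite !mulr1n -rmorphM/=; have [->|s0] := eqVneq (singular_value A i) 0.
    by rewrite mulr0.
  by rewrite mulVf.
have sgisg : sg *m isg = e by rewrite -isgsg diag_mxC.
have isge : isg *m e = isg.
  apply/matrixP => i j; rewrite mul_diag_mx !mxE.
  have [_|_] := eqVneq i j; last by rewrite mulr0.
  rewrite !mulr1n; have [->|s0] := eqVneq (singular_value A i) 0.
    by rewrite mulr0 invr0.
  by rewrite mulr1.
have ee : e *m e = e by rewrite -{1}sgisg -mulmxA isge sgisg.
have isgadj : isg^t* = isg.
  rewrite tr_diag_mx map_diag_mx; congr diag_mx; apply/rowP => i; rewrite !mxE.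
  by apply: conj_Creal; apply/complex_realP; eexists.
have colsqW i : colsq W i = singular_value A i ^+ 2.
  by rewrite sqr_singular_value.
have AV : toC A *m eigbasis A = W by [].
move: (eigbasis A) VV W WW colsqW AV => V VV W WW colsqW AV.
(* A column of [W] at a zero singular value has squared norm 0, hence vanishes; this gives
   [A V = Q sg] in the degenerate directions too. *)
have We : W *m e = W.
  apply/matrixP => j i; rewrite mul_mx_diag !mxE.
  have [s0|s0] := eqVneq (singular_value A i) 0; last by rewrite mulr1.
  rewrite mulr0; have : colsq W i = 0 by rewrite colsqW s0 expr0n.
  move/eqP; rewrite psumr_eq0; last by move=> k _; rewrite sqr_ge0.
  move/allP/(_ j); rewrite mem_index_enum => /(_ isT); rewrite sqrf_eq0.
  by move=> /eqP/Normc.eq0_normc ->.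
pose Q := W *m isg.
have QQ : Q^t* *m Q = e.
  rewrite adjmxM isgadj -mulmxA (mulmxA _ W) WW -(mulmxA sg) sgisg.
  by rewrite mulmxA isgsg ee.
have Qe : Q *m e = Q by rewrite /Q -mulmxA isge.
have Wdef : W = Q *m sg by rewrite /Q -mulmxA isgsg We.
rewrite -AV in Wdef; move: Q QQ Qe Wdef => Q QQ Qe Wdef.
exists Q, V; split => //.
- rewrite -mulmxA Wdef mulmxA QQ.
  apply/matrixP => i j; rewrite !mul_diag_mx !mxE.
  have [_|_] := eqVneq i j; last by rewrite !mulr0.
  rewrite !mulr1n; have [->|s0] := eqVneq (singular_value A i) 0.
    by rewrite mulr0.
  by rewrite mul1r.
- move=> i; rewrite -lecR -gram_colsq QQ mxE eqxx mulr1n mxE.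
  by case: eqP; rewrite /= ?ler01 ?lexx.
- move=> m Z i; have Padj : (Q *m Q^t* )^t* = Q *m Q^t*.
    by rewrite adjmxM trmxCK.
  have PP : (Q *m Q^t* ) *m (Q *m Q^t* ) = Q *m Q^t*.
    by rewrite -mulmxA (mulmxA _ Q) QQ mulmxA Qe.
  have e1 : (Q^t* *m Z)^t* *m (Q^t* *m Z) = Z^t* *m (Q *m Q^t* *m Z).
    by rewrite (adjmxM (Q^t* ) Z) (trmxCK Q) -mulmxA (mulmxA Q).
  move: (Q *m Q^t* ) Padj PP e1 => P Padj PP e1.
  have e2 : (P *m Z)^t* *m (P *m Z) = Z^t* *m (P *m Z).
    by rewrite (adjmxM P Z) Padj -mulmxA (mulmxA P) PP.
  have /complexI -> : (colsq (Q^t* *m Z) i)%:C = (colsq (P *m Z) i)%:C.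
    by rewrite -(gram_colsq (Q^t* *m Z)) e1 -e2 gram_colsq.
  exact: colsq_proj_le.
Qed.

End SingularValues.

(** * The triangle inequality for Schatten norms *)

Section SchattenTriangle.
Local Open Scope sesquilinear_scope.
Local Open Scope complex_scope.
Variable R : realType.
Local Notation C := R[i].
Local Notation toC := (map_mx (real_complex R)).
Local Notation normc := Normc.normc.

Lemma normc_ge0 (z : C) : 0 <= normc z.
Proof. by case: z => a b; exact: sqrtr_ge0. Qed.

Lemma normc_sum (I : Type) (r : seq I) (F : I -> C) :
  normc (\sum_(i <- r) F i) <= \sum_(i <- r) normc (F i).
Proof.
elim/big_ind2: _ => [|x1 x2 y1 y2 h1 h2|//]; first by rewrite Normc.normc0.
exact: le_trans (le_normcD _ _) (lerD h1 h2).
Qed.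

Lemma normc_conj (z : C) : normc (Num.conj z) = normc z.
Proof. by apply: (@complexI R); exact: (norm_conjC z). Qed.

Lemma colsq_adj (m n : nat) (Z : 'M[C]_(m, n)) i :
  colsq (Z^t* ) i = \sum_j normc (Z i j) ^+ 2.
Proof. by apply: eq_bigr => j _; rewrite !mxE normc_conj. Qed.

(** With [A = Q S V^*] the diagonal entry is [\sum_k E i k * s k * H k i]. By the
    arithmetic-geometric mean inequality its modulus is at most [\sum_k w i k * s k], where the rows
    and columns of [w] have sum at most 1. Jensen's inequality on rows and an exchange of sums
    conclude. *)
Lemma pinching_powR_le (n : nat) (p : R) (A : 'M[R]_n) (X Y : 'M[C]_n) :
  1 <= p -> (forall i, colsq X i <= 1) ->
  (forall (Z : 'M[C]_n) i, colsq (X^t* *m Z) i <= colsq Z i) ->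
  Y *m Y^t* = 1%:M ->
  \sum_i normc ((X^t* *m toC A *m Y) i i) `^ p <= \sum_i singular_value A i `^ p.
Proof.
move=> p1 Xle1 Xcontr YY; have [Q [V [VV AV _ Qle1 Qcontr]]] := svd A.
have YY' : Y^t* *m Y = 1%:M by exact: mulmx1C.
have VV' : V^t* *m V = 1%:M by exact: mulmx1C.
pose E := X^t* *m Q; pose H := V^t* *m Y.
have defM : X^t* *m toC A *m Y =
    E *m diag_mx (\row_i (singular_value A i)%:C) *m H.
  by rewrite /E /H -(mulmxA _ Q) -AV -!mulmxA (mulmxA V) VV mul1mx.
pose w i k := (normc (E i k) ^+ 2 + normc (H k i) ^+ 2) / 2.
have w0 i k : 0 <= w i k by rewrite divr_ge0// addr_ge0// sqr_ge0.
have Erow i : \sum_k normc (E i k) ^+ 2 <= 1.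
  rewrite -colsq_adj adjmxM trmxCK; exact: le_trans (Qcontr _ _ _) (Xle1 i).
have Ecol k : \sum_i normc (E i k) ^+ 2 <= 1.
  exact: le_trans (Xcontr _ _) (Qle1 k).
have Hcol i : \sum_k normc (H k i) ^+ 2 = 1.
  by rewrite -[LHS]/(colsq H i) colsq_isometry// colsq_unitary.
have Hrow k : \sum_i normc (H k i) ^+ 2 = 1.
  by rewrite -colsq_adj adjmxM trmxCK colsq_isometry// colsq_unitary.
have wrow i : \sum_k w i k <= 1.
  by rewrite -mulr_suml big_split/= Hcol; have := Erow i; lra.
have wcol k : \sum_i w i k <= 1.
  by rewrite -mulr_suml big_split/= Hrow; have := Ecol k; lra.
have p0 : 0 <= p by lra.
apply: (@le_trans _ _ (\sum_i \sum_k w i k * singular_value A k `^ p)); last first.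
  rewrite exchange_big/=; apply: ler_sum => k _; rewrite -mulr_suml.
  by rewrite ler_piMl ?powR_ge0.
apply: ler_sum => i _.
apply: le_trans (powR_jensen p1 (w0 i) (singular_value_ge0 A) (wrow i)).
apply: ge0_ler_powR => //; rewrite ?nnegrE ?normc_ge0//.
  by apply: sumr_ge0 => k _; rewrite mulr_ge0// singular_value_ge0.
rewrite defM mxE; apply: le_trans (normc_sum _ _) _; apply: ler_sum => k _.
rewrite mul_mx_diag [X in X * _]mxE [X in _ * X * _]mxE !Normc.normcM.
have -> : normc (singular_value A k)%:C = singular_value A k.
  by rewrite /= expr0n/= addr0 sqrtr_sqr ger0_norm// singular_value_ge0.
rewrite /w.
have := singular_value_ge0 A k; have := sqr_ge0 (normc (E i k) - normc (H k i)).
move: (normc (E i k)) (normc (H k i)) (singular_value A k) => x y s xy s0.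
rewrite mulrAC; apply: ler_wpM2r => //; nra.
Qed.

(** The singular values of [A + B] are the diagonal of [Q^* (A + B) V], which is linear in the
    matrix: pinching bounds the two parts and Minkowski's inequality adds them. *)
Lemma schatten_powR_leD (n : nat) (p a b : R) (A B : 'M[R]_n) :
  1 <= p -> 0 < a -> 0 < b ->
  \sum_i singular_value A i `^ p <= a `^ p ->
  \sum_i singular_value B i `^ p <= b `^ p ->
  \sum_i singular_value (A + B) i `^ p <= (a + b) `^ p.
Proof.
move=> p1 a0 b0 Aa Bb; have [Q [V [VV _ QAV Qle1 Qcontr]]] := svd (A + B).
have p0 : 0 <= p by lra.
pose x i := normc ((Q^t* *m toC A *m V) i i).
pose y i := normc ((Q^t* *m toC B *m V) i i).
have hx : \sum_i x i `^ p <= a `^ p by apply: le_trans Aa; exact: pinching_powR_le.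
have hy : \sum_i y i `^ p <= b `^ p by apply: le_trans Bb; exact: pinching_powR_le.
have sxy i : singular_value (A + B) i <= x i + y i.
  apply: le_trans (le_normcD _ _).
  have := congr1 (fun M : 'M[C]_n => M i i) QAV.
  rewrite map_mxD mulmxDr mulmxDl mxE [in RHS]mxE [X in X *+ _]mxE eqxx mulr1n.
  move=> ->; rewrite /= expr0n/= addr0 sqrtr_sqr ger0_norm// singular_value_ge0//.
apply: powR_minkowski hx hy => // i; rewrite ?normc_ge0// singular_value_ge0.
exact: sxy.
Qed.

Lemma schatten_norm_le (n : nat) (p a : R) (A : 'M[R]_n) : 1 <= p -> 0 < a ->
  (schatten_norm p A <= a) = (\sum_i singular_value A i `^ p <= a `^ p).
Proof.
move=> p1 a0; have p0 : 0 < p by lra.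
have S0 : 0 <= \sum_i singular_value A i `^ p.
  by apply: sumr_ge0 => i _; exact: powR_ge0.
rewrite /schatten_norm; apply/idP/idP => h.
  have := @ge0_ler_powR R p (ltW p0) _ _ _ _ h.
  by rewrite -powRrM mulVf ?gt_eqF// powRr1//; apply; rewrite nnegrE ?powR_ge0// ltW.
have ae : (a `^ p) `^ p^-1 = a by rewrite -powRrM mulfV ?gt_eqF// powRr1// ltW.
by rewrite -[leRHS]ae; apply: ge0_ler_powR; rewrite ?nnegrE ?invr_ge0 ?powR_ge0 ?(ltW p0).
Qed.

Lemma schatten_norm_leD (n : nat) (p a b : R) (A B : 'M[R]_n) :
  1 <= p -> 0 < a -> 0 < b -> schatten_norm p A <= a -> schatten_norm p B <= b ->
  schatten_norm p (A + B) <= a + b.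
Proof.
move=> p1 a0 b0 hA hB.
have hA' := eqbLR (schatten_norm_le A p1 a0) hA.
have hB' := eqbLR (schatten_norm_le B p1 b0) hB.
apply: (eqbRL (schatten_norm_le (A + B) p1 (addr_gt0 a0 b0))).
exact: schatten_powR_leD p1 a0 b0 hA' hB'.
Qed.

End SchattenTriangle.

(** * Uniform averages and probabilities on finite types *)

Section Averages.
Variable R : realType.

(** Expectation under the uniform law; it is 0 on an empty type, as [0^-1 = 0]. *)
Definition avg (S : finType) (f : S -> R) : R := (\sum_s f s) / #|S|%:R.

Definition pr (S : finType) (Q : pred S) : R := avg (fun s => (Q s)%:R).

Lemma eq_avg (S : finType) (f g : S -> R) : f =1 g -> avg f = avg g.
Proof. by move=> fg; rewrite /avg (eq_bigr g). Qed.

Lemma ler_avg (S : finType) (f g : S -> R) : (forall s, f s <= g s) -> avg f <= avg g.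
Proof. by move=> fg; rewrite ler_wpM2r ?invr_ge0// ler_sum. Qed.

Lemma avg_ge0 (S : finType) (f : S -> R) : (forall s, 0 <= f s) -> 0 <= avg f.
Proof. by move=> f0; rewrite divr_ge0// sumr_ge0. Qed.

Lemma avgD (S : finType) (f g : S -> R) : avg (fun s => f s + g s) = avg f + avg g.
Proof. by rewrite /avg big_split/= mulrDl. Qed.

Lemma avgZ (S : finType) (c : R) (f : S -> R) : avg (fun s => c * f s) = c * avg f.
Proof. by rewrite /avg -mulr_sumr mulrA. Qed.

Lemma avgN (S : finType) (f : S -> R) : avg (fun s => - f s) = - avg f.
Proof. by rewrite /avg sumrN mulNr. Qed.

Lemma avg_sum (S I : finType) (f : I -> S -> R) :
  avg (fun s => \sum_i f i s) = \sum_i avg (f i).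
Proof. by rewrite /avg exchange_big/= mulr_suml. Qed.

Lemma avg_const (S : finType) (c : R) : (0 < #|S|)%N -> avg (fun _ : S => c) = c.
Proof.
by move=> S0; rewrite /avg sumr_const -[c *+ _]mulr_natr mulfK// pnatr_eq0 -lt0n.
Qed.

Lemma avg_le_const (S : finType) (f : S -> R) (c : R) :
  0 <= c -> (forall s, f s <= c) -> avg f <= c.
Proof.
move=> c0 fc; have [S0|S0] := posnP #|S|.
  by rewrite /avg S0 invr0 mulr0.
by rewrite -[leRHS](avg_const c S0); exact: ler_avg.
Qed.

Lemma avg_pair (S1 S2 : finType) (f : S1 * S2 -> R) :
  avg f = avg (fun x => avg (fun y => f (x, y))).
Proof.
rewrite /avg card_prod natrM invfM mulrA mulrAC -mulr_suml; congr (_ * _ * _).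
by rewrite pair_bigA/=; apply: eq_bigr => -[].
Qed.

Lemma avg_tuple0 (S : finType) (f : 0.-tuple S -> R) : avg f = f [tuple].
Proof.
rewrite /avg (bigD1 [tuple])//= big1 ?addr0; last by move=> t /negP[]; apply/eqP; exact: tuple0.
by rewrite card_tuple expn0 divr1.
Qed.

Lemma avg_tupleS (S : finType) (n : nat) (f : n.+1.-tuple S -> R) :
  avg f = avg (fun x => avg (fun t : n.-tuple S => f [tuple of x :: t])).
Proof.
rewrite -(avg_pair (fun xt : S * n.-tuple S => f [tuple of xt.1 :: xt.2])).
rewrite /avg card_prod !card_tuple expnS; congr (_ / _).
rewrite (reindex (fun xt : S * n.-tuple S => [tuple of xt.1 :: xt.2]))//=.
exists (fun t => (thead t, [tuple of behead t])) => [[x t] _|t _] /=.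
  by congr pair; apply: val_inj.
by rewrite [in RHS](tuple_eta t).
Qed.

(** Markov's inequality; [f] will be a square (Chebyshev) or an exponential (Chernoff). *)
Lemma pr_le_avg (S : finType) (Q : pred S) (f : S -> R) :
  (forall s, 0 <= f s) -> (forall s, Q s -> 1 <= f s) -> pr Q <= avg f.
Proof. by move=> f0 f1; apply: ler_avg => s; case: (boolP (Q s)) => // /f1. Qed.

Lemma pr_sub (S : finType) (P Q : pred S) : (forall s, P s -> Q s) -> pr P <= pr Q.
Proof.
by move=> PQ; apply: ler_avg => s; rewrite ler_nat; case: (boolP (P s)) => // /PQ ->.
Qed.

Lemma pr_le1 (S : finType) (Q : pred S) : pr Q <= 1.
Proof. by apply: avg_le_const => // s; case: (Q s). Qed.

Lemma prU (S : finType) (P Q : pred S) : pr (fun s => P s || Q s) <= pr P + pr Q.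
Proof.
rewrite /pr -avgD; apply: ler_avg => s.
by rewrite -natrD ler_nat; case: (P s); case: (Q s).
Qed.

Lemma prC (S : finType) (Q : pred S) : (0 < #|S|)%N -> pr (predC Q) = 1 - pr Q.
Proof.
move=> S0; rewrite -[X in X - _](avg_const 1 S0) /pr -avgN -avgD.
by apply: eq_avg => s /=; case: (Q s); rewrite /= ?subrr ?subr0.
Qed.

(** Number of hits along a trajectory driven by the samples [s]; each hit is tested in the state
    before the update. *)
Fixpoint runcount (S Z : Type) (step : Z -> S -> Z) (hit : Z -> S -> bool)
    (z : Z) (s : seq S) : nat :=
  if s is x :: s' then hit z x + runcount step hit (step z x) s' else 0.

(** The rounds are adaptive, but given the past each one contributes a factor at most [rho] on
    average; peeling off the first sample multiplies these factors. *)
Lemma avg_exp_runcount (S : finType) (Z : Type) (Inv : Z -> Prop)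
    (step : Z -> S -> Z) (hit : Z -> S -> bool) (lam rho : R) :
  0 <= lam -> (forall z x, Inv z -> Inv (step z x)) ->
  (forall z, Inv z -> avg (fun x => lam ^+ hit z x) <= rho) ->
  forall (N : nat) (z : Z), Inv z ->
  avg (fun t : N.-tuple S => lam ^+ runcount step hit z t) <= rho ^+ N.
Proof.
move=> lam0 Istep hle; elim=> [|N IHN] z Iz; first by rewrite avg_tuple0.
rewrite avg_tupleS.
have rho0 : 0 <= rho.
  by apply: le_trans (hle z Iz); apply: avg_ge0 => x; rewrite exprn_ge0.
apply: (@le_trans _ _ (avg (fun x => rho ^+ N * lam ^+ hit z x))).
  apply: ler_avg => x /=.
  have -> : avg (fun t : N.-tuple S => lam ^+ (hit z x + runcount step hit (step z x) t)) =
            lam ^+ hit z x * avg (fun t : N.-tuple S => lam ^+ runcount step hit (step z x) t).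
    by rewrite -avgZ; apply: eq_avg => t; rewrite exprD.
  by rewrite mulrC ler_wpM2r ?exprn_ge0//; apply: IHN; exact: Istep.
by rewrite avgZ exprSr ler_wpM2l ?exprn_ge0// hle.
Qed.

End Averages.

(** * Random sign vectors and moments of their quadratic forms *)

Section RandomSigns.
Variables (R : realType) (n : nat).

Definition signs := {ffun 'I_n -> bool}.

Definition sgnv (w : signs) : 'cV[R]_n := \col_i (-1) ^+ w i.

Local Notation sg w i := ((-1 : R) ^+ (w : signs) i).

Lemma card_signs_gt0 : (0 < #|signs|)%N.
Proof. by apply/card_gt0P; exists [ffun=> true]. Qed.

Definition flip (t : 'I_n) (w : signs) : signs := [ffun i => (i == t) (+) w i].

Lemma flipK t : involutive (flip t).
Proof. by move=> w; apply/ffunP => i; rewrite !ffunE addbA addbb. Qed.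

(** Flipping one sign is an involution, so it preserves the uniform law. *)
Lemma avg_odd_eq0 (t : 'I_n) (f : signs -> R) :
  (forall w, f (flip t w) = - f w) -> avg f = 0.
Proof.
move=> fodd; have : avg f = - avg f.
  rewrite -avgN /avg [in LHS](reindex_inj (inv_inj (flipK t)))/=.
  by congr (_ / _); apply: eq_bigr => w _; rewrite fodd.
by move=> /eqP; rewrite -addr_eq0 -mulr2n mulrn_eq0/= => /eqP.
Qed.

Lemma flip_same t (w : signs) : sg (flip t w) t = - sg w t.
Proof. by rewrite ffunE eqxx/= signrN. Qed.

Lemma flip_other t i (w : signs) : i != t -> sg (flip t w) i = sg w i.
Proof. by move=> it; rewrite ffunE (negbTE it). Qed.

Lemma sqr_sgn i (w : signs) : sg w i * sg w i = 1.
Proof. by rewrite -expr2 sqrr_sign. Qed.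

Lemma avg_sgn2 i j : avg (fun w : signs => sg w i * sg w j) = (i == j)%:R.
Proof.
have [<-|ij] := eqVneq i j.
  by rewrite (eq_avg (sqr_sgn i)) avg_const// card_signs_gt0.
apply: (avg_odd_eq0 (t := i)) => w.
by rewrite flip_same flip_other ?mulNr// eq_sym.
Qed.

(** A product of signs has nonzero mean only if its indices can be paired off; the case [i = j]
    covers the pairing of [i] with [j]. *)
Lemma avg_sgn4 i j k l :
  avg (fun w : signs => sg w i * sg w j * (sg w k * sg w l)) =
  if i == j then (k == l)%:R
  else ((i == k) && (j == l))%:R + ((i == l) && (j == k))%:R.
Proof.
have [<-|ij] := eqVneq i j.
  by rewrite -avg_sgn2; apply: eq_avg => w; rewrite sqr_sgn mul1r.
have [<-|ik] := eqVneq i k.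
  have -> : ((i == l) && (j == i))%:R = 0 :> R by rewrite [j == i]eq_sym (negbTE ij) andbF.
  rewrite addr0 /= -avg_sgn2; apply: eq_avg => w.
  by rewrite mulrACA sqr_sgn mul1r.
have [<-|il] := eqVneq i l.
  rewrite add0r /= -avg_sgn2; apply: eq_avg => w.
  by rewrite [sg w k * _]mulrC mulrACA sqr_sgn mul1r.
rewrite addr0; apply: (avg_odd_eq0 (t := i)) => w.
by rewrite flip_same !flip_other ?mulNr// eq_sym.
Qed.

Definition quadf (G : 'M[R]_n) (x : 'cV[R]_n) : R := (x^T *m G *m x) 0 0.

Definition fro2 (m k : nat) (G : 'M[R]_(m, k)) : R := \sum_i \sum_j G i j ^+ 2.

Lemma quadfE (G : 'M[R]_n) (w : signs) :
  quadf G (sgnv w) = \sum_i \sum_j G i j * (sg w i * sg w j).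
Proof.
rewrite /quadf mxE exchange_big/=; apply: eq_bigr => j _.
rewrite !mxE mulr_suml; apply: eq_bigr => i _; rewrite !mxE; ring.
Qed.

Lemma avg_quadf (G : 'M[R]_n) : avg (fun w => quadf G (sgnv w)) = \tr G.
Proof.
rewrite (eq_avg (quadfE G)) avg_sum; apply: eq_bigr => i _.
rewrite avg_sum (bigD1 i)//= big1 ?addr0 => [|j ji].
  by rewrite avgZ avg_sgn2 eqxx mulr1.
by rewrite avgZ avg_sgn2 eq_sym (negbTE ji) mulr0.
Qed.

Lemma sum_delta (G : 'M[R]_n) i j :
  \sum_k \sum_l G k l * ((i == k) && (j == l))%:R = G i j.
Proof.
rewrite (bigD1 i)//= [X in _ + X]big1 ?addr0; last first.
  by move=> k ki; apply: big1 => l _; rewrite eq_sym (negbTE ki) mulr0.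
rewrite (bigD1 j)//= !eqxx mulr1 big1 ?addr0// => l lj.
by rewrite [j == l]eq_sym (negbTE lj) mulr0.
Qed.

Lemma avg_quadf2_le (G : 'M[R]_n) :
  avg (fun w => quadf G (sgnv w) ^+ 2) <= \tr G ^+ 2 + 2 * fro2 G.
Proof.
have -> : avg (fun w => quadf G (sgnv w) ^+ 2) =
    \sum_i \sum_j G i j * (if i == j then \tr G else G i j + G j i).
  transitivity (avg (fun w => \sum_i \sum_j \sum_k \sum_l
      (G i j * (G k l * (sg w i * sg w j * (sg w k * sg w l)))))).
    apply: eq_avg => w; rewrite quadfE expr2 mulr_suml; apply: eq_bigr => i _.
    rewrite mulr_suml; apply: eq_bigr => j _.
    rewrite mulr_sumr; apply: eq_bigr => k _.
    rewrite mulr_sumr; apply: eq_bigr => l _; ring.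
  rewrite avg_sum; apply: eq_bigr => i _; rewrite avg_sum; apply: eq_bigr => j _.
  transitivity (G i j * \sum_k \sum_l G k l *
      avg (fun w : signs => sg w i * sg w j * (sg w k * sg w l))).
    rewrite avg_sum mulr_sumr; apply: eq_bigr => k _.
    rewrite avg_sum mulr_sumr; apply: eq_bigr => l _.
    by rewrite !avgZ.
  congr (_ * _); under eq_bigr do under eq_bigr do rewrite avg_sgn4.
  have [ij|ij] := eqVneq i j.
    apply: eq_bigr => k _; rewrite (bigD1 k)//= eqxx mulr1 big1 ?addr0// => l lk.
    by rewrite eq_sym (negbTE lk) mulr0.
  rewrite -[in RHS](sum_delta G i j) -[in RHS](sum_delta G j i) -big_split/=.
  apply: eq_bigr => k _; rewrite -big_split/=; apply: eq_bigr => l _.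
  by rewrite mulrDr [(i == l) && _]andbC.
(* Off the diagonal, [G i j * G j i] is at most half the sum of the two squares, whence the
   coefficients [3/2] and [1/2]; on the diagonal the squares are simply added. *)
apply: (@le_trans _ _ (\sum_i \sum_j ((i == j)%:R * G i i * \tr G
    + (G i j ^+ 2 * (3 / 2) + G j i ^+ 2 / 2)))).
  apply: ler_sum => i _; apply: ler_sum => j _.
  have [<-|_] := eqVneq i j; first by rewrite /= mul1r; have := sqr_ge0 (G i i); lra.
  rewrite /= !mul0r add0r.
  have := sqr_ge0 (G i j - G j i); nra.
have -> : \sum_i \sum_j ((i == j)%:R * G i i * \tr G
    + (G i j ^+ 2 * (3 / 2) + G j i ^+ 2 / 2)) =
   \sum_i G i i * \tr G + (fro2 G * (3 / 2) + (\sum_i \sum_j G j i ^+ 2) / 2).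
  rewrite /fro2 !mulr_suml -!big_split/=; apply: eq_bigr => i _.
  rewrite !mulr_suml !big_split/=; congr (_ + _).
  rewrite (bigD1 i)//= eqxx mul1r big1 ?addr0// => j ji.
  by rewrite eq_sym (negbTE ji) !mul0r.
rewrite -mulr_suml -/(\tr G) [X in _ + (_ + X / 2)]exchange_big/= -/(fro2 G).
lra.
Qed.

Lemma avg_quadf_var_le (G : 'M[R]_n) :
  avg (fun w => (quadf G (sgnv w) - \tr G) ^+ 2) <= 2 * fro2 G.
Proof.
have -> : avg (fun w => (quadf G (sgnv w) - \tr G) ^+ 2) =
    avg (fun w => quadf G (sgnv w) ^+ 2) - \tr G ^+ 2.
  transitivity (avg (fun w => quadf G (sgnv w) ^+ 2
      + ((- 2 * \tr G) * quadf G (sgnv w) + \tr G ^+ 2))).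
    by apply: eq_avg => w; ring.
  by rewrite !avgD avgZ avg_quadf avg_const ?card_signs_gt0//; ring.
have := avg_quadf2_le G; lra.
Qed.

End RandomSigns.

(** * Cauchy-Schwarz and the squared Frobenius norm *)

Section Frobenius.
Variable R : realType.

(** Lagrange's identity: the two sides differ by half the sum of all [(a i b j - a j b i)^2]. *)
Lemma cauchy_schwarz_sum (I : finType) (a b : I -> R) :
  (\sum_i a i * b i) ^+ 2 <= (\sum_i a i ^+ 2) * (\sum_i b i ^+ 2).
Proof.
have : 0 <= \sum_i \sum_j (a i * b j - a j * b i) ^+ 2.
  by apply: sumr_ge0 => i _; apply: sumr_ge0 => j _; exact: sqr_ge0.
have -> : \sum_i \sum_j (a i * b j - a j * b i) ^+ 2 =
    2 * ((\sum_i a i ^+ 2) * (\sum_i b i ^+ 2) - (\sum_i a i * b i) ^+ 2).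
  transitivity (\sum_i \sum_j (a i ^+ 2 * b j ^+ 2 + b i ^+ 2 * a j ^+ 2
      + (- 2 * (a i * b i)) * (a j * b j))).
    by apply: eq_bigr => i _; apply: eq_bigr => j _; ring.
  transitivity (\sum_i (a i ^+ 2 * (\sum_j b j ^+ 2) + b i ^+ 2 * (\sum_j a j ^+ 2)
      + (- 2 * (a i * b i)) * (\sum_j a j * b j))).
    by apply: eq_bigr => i _; rewrite !big_split/= !mulr_sumr.
  rewrite !big_split/= -!mulr_suml -mulr_sumr; ring.
by rewrite pmulr_rge0// subr_ge0.
Qed.

Lemma fro2_ge0 (m k : nat) (G : 'M[R]_(m, k)) : 0 <= fro2 G.
Proof. by apply: sumr_ge0 => i _; apply: sumr_ge0 => j _; exact: sqr_ge0. Qed.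

Lemma fro2E (m k : nat) (G : 'M[R]_(m, k)) : fro2 G = \tr (G^T *m G).
Proof.
rewrite /fro2 exchange_big/=; apply: eq_bigr => j _; rewrite mxE.
by apply: eq_bigr => i _; rewrite mxE expr2.
Qed.

Lemma fro2_tr (m k : nat) (G : 'M[R]_(m, k)) : fro2 G^T = fro2 G.
Proof.
rewrite /fro2 exchange_big/=; apply: eq_bigr => i _.
by apply: eq_bigr => j _; rewrite mxE.
Qed.

Lemma fro2M_le (m k l : nat) (G : 'M[R]_(m, k)) (H : 'M[R]_(k, l)) :
  fro2 (G *m H) <= fro2 G * fro2 H.
Proof.
rewrite /fro2 mulr_suml; apply: ler_sum => i _.
rewrite [\sum_i0 \sum_j H i0 j ^+ 2]exchange_big/= mulr_sumr; apply: ler_sum => j _.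
rewrite mxE; exact: cauchy_schwarz_sum.
Qed.

Definition sqn (n : nat) (v : 'cV[R]_n) : R := (v^T *m v) 0 0.

Lemma sqnE (n : nat) (v : 'cV[R]_n) : sqn v = \sum_i v i 0 ^+ 2.
Proof. by rewrite /sqn mxE; apply: eq_bigr => i _; rewrite mxE expr2. Qed.

Lemma sqn_ge0 (n : nat) (v : 'cV[R]_n) : 0 <= sqn v.
Proof. by rewrite sqnE sumr_ge0// => i _; exact: sqr_ge0. Qed.

Lemma sqn_eq0 (n : nat) (v : 'cV[R]_n) : sqn v = 0 -> v = 0.
Proof.
rewrite sqnE => /eqP; rewrite psumr_eq0; last by move=> i _; exact: sqr_ge0.
move=> /allP h; apply/matrixP => i j; rewrite ord1 mxE; apply/eqP.
by rewrite -sqrf_eq0; have := h i; rewrite mem_index_enum; apply.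
Qed.

Lemma sqn_mul (n : nat) (v : 'cV[R]_n) : v^T *m v = (sqn v)%:M.
Proof. by apply/matrixP => i j; rewrite !ord1 [RHS]mxE eqxx mulr1n. Qed.

Lemma tr_outer (n : nat) (u v : 'cV[R]_n) : \tr (u *m v^T) = (v^T *m u) 0 0.
Proof. by rewrite mxtrace_mulC trace_mx11. Qed.

End Frobenius.

(** * Numerical bounds for the probability of progress *)

Section ProgressNumerics.
Variable R : realType.

(** With the next lemma: the parabola lies above the function equal to 1 for [t <= 0] and to [1/2]
    for [t > 0]. *)
Lemma ge_half_parabola (t : R) : 2^-1 <= 1 - t + 2^-1 * t ^+ 2.
Proof. have := sqr_ge0 (t - 1); rewrite sqrrB1; lra. Qed.

Lemma ge1_parabola (t : R) : t <= 0 -> 1 <= 1 - t + 2^-1 * t ^+ 2.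
Proof. have := sqr_ge0 t; lra. Qed.

(** In [u = l * T] the expression is at most [1 - 3u/4 + 51u^2/32], which is least at [u = 4/17];
    this explains [l]. The minimum is [31/34], just below [11/12]. *)
Lemma second_moment_bound (T F z y : R) (a := T / (4 * F)) (l := 4 / (17 * T)) :
  0 < T -> 0 < F -> z <= 3 * T ^+ 2 -> y <= 3 * F ^+ 2 ->
  1 + (- l * T + (l * a * F
    + (2^-1 * l ^+ 2 * z + 2^-1 * l ^+ 2 * a ^+ 2 * y))) <= 11 / 12.
Proof.
move=> T0 F0 hz hy.
have c1 : l * T = 4 / 17 by rewrite /l; field; rewrite gt_eqF.
have c2 : a * F = T / 4 by rewrite /a; field; rewrite gt_eqF.
have l2 : 0 <= 2^-1 * l ^+ 2 by rewrite mulr_ge0 ?sqr_ge0.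
have e1 : 2^-1 * l ^+ 2 * z <= 3 / 2 * (l * T) ^+ 2.
  by apply: le_trans (ler_wpM2l l2 hz) _; rewrite le_eqVlt; apply/orP; left; apply/eqP; field.
have e2 : 2^-1 * l ^+ 2 * a ^+ 2 * y <= 3 / 2 * (l * (a * F)) ^+ 2.
  apply: le_trans (ler_wpM2l (mulr_ge0 l2 (sqr_ge0 a)) hy) _.
  by rewrite le_eqVlt; apply/orP; left; apply/eqP; field.
have e3 : l * (a * F) = 1 / 17 by rewrite c2 mulrA c1; field.
rewrite mulNr -(mulrA l) e3 c1; rewrite e3 in e2; rewrite c1 in e1.
move: e1 e2; set u := 2^-1 * l ^+ 2 * z; set v := 2^-1 * l ^+ 2 * a ^+ 2 * y.
clear; lra.
Qed.

End ProgressNumerics.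

(** * Projecting out random images, and the energy lost in one round *)

Section Deflation.
Variables (R : realType) (n : nat).

Definition projector (D : 'M[R]_n) : Prop := D^T = D /\ D *m D = D.

(* If [D *m y = 0], the inverse is [0^-1 = 0] and [D] is unchanged. *)
Definition deflate (D : 'M[R]_n) (y : 'cV[R]_n) : 'M[R]_n :=
  D - (sqn (D *m y))^-1 *: ((D *m y) *m (D *m y)^T).

Lemma projector1 : projector 1%:M.
Proof. by split; rewrite ?trmx1 ?mulmx1. Qed.

Lemma deflate_projector D y : projector D -> projector (deflate D y).
Proof.
move=> [Dsym DD]; rewrite /deflate.
have Dz : D *m (D *m y) = D *m y by rewrite mulmxA DD.
move: (D *m y) Dz => z Dz; set c := (sqn z)^-1.
have zD : z^T *m D = z^T by rewrite -{1}Dsym -trmx_mul Dz.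
split; first by rewrite linearB/= linearZ/= trmx_mul trmxK Dsym.
have XD : c *: (z *m z^T) *m D = c *: (z *m z^T) by rewrite -scalemxAl -mulmxA zD.
have DX : D *m (c *: (z *m z^T)) = c *: (z *m z^T) by rewrite -scalemxAr mulmxA Dz.
have XX : (c *: (z *m z^T)) *m (c *: (z *m z^T)) = c *: (z *m z^T).
  rewrite -scalemxAl -scalemxAr -mulmxA (mulmxA z^T) sqn_mul mul_scalar_mx.
  rewrite -scalemxAr !scalerA; congr (_ *: _); rewrite /c.
  have [->|z0] := eqVneq (sqn z) 0; first by rewrite invr0 !mul0r.
  by rewrite mulVf// mulr1.
by rewrite mulmxBr !mulmxBl DD XD DX XX subrr subr0.
Qed.

Variable B : 'M[R]_n.

Definition rgram (D : 'M[R]_n) : 'M[R]_n := B^T *m D *m B.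

Definition energy (D : 'M[R]_n) : R := \tr (rgram D).

Definition sketch (D : 'M[R]_n) (w : signs n) : 'M[R]_n := deflate D (B *m sgnv R w).

(** The energy drops by [x^T K^2 x / x^T K x], whose numerator and denominator have means [fro2 K]
    and [energy D]; a quarter of the ratio of the means is asked for. *)
Definition progress (D : 'M[R]_n) (w : signs n) : bool :=
  energy (sketch D w) <= energy D - fro2 (rgram D) / (4 * energy D).

Lemma rgram_sym D : projector D -> (rgram D)^T = rgram D.
Proof. by move=> [Dsym _]; rewrite /rgram !trmx_mul trmxK Dsym mulmxA. Qed.

Lemma rgramE D : projector D -> rgram D = (D *m B)^T *m (D *m B).
Proof. by move=> [Dsym DD]; rewrite trmx_mul Dsym -mulmxA (mulmxA D) DD /rgram mulmxA. Qed.

Lemma energyE D : projector D -> energy D = fro2 (D *m B).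
Proof. by move=> hD; rewrite fro2E /energy rgramE. Qed.

Lemma energy_ge0 D : projector D -> 0 <= energy D.
Proof. by move=> hD; rewrite energyE// fro2_ge0. Qed.

Lemma fro2_rgram_le D : projector D -> fro2 (rgram D) <= energy D ^+ 2.
Proof.
by move=> hD; rewrite rgramE// energyE//; apply: le_trans (fro2M_le _ _) _; rewrite fro2_tr.
Qed.

Lemma quadf_rgram D x : projector D -> quadf (rgram D) x = sqn (D *m (B *m x)).
Proof. by move=> hD; rewrite /quadf rgramE// /sqn !trmx_mul !mulmxA. Qed.

Lemma quadf_rgram2 D x : projector D ->
  quadf (rgram D *m rgram D) x = sqn (rgram D *m x).
Proof. by move=> hD; rewrite /quadf /sqn trmx_mul rgram_sym// !mulmxA. Qed.

(** With [z = D B x], deflation subtracts the rank-one matrix [(B^T z) (B^T z)^T / |z|^2] from [K].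
    Here [B^T z = K x] and [|z|^2 = x^T K x]. *)
Lemma energy_sketch D w : projector D ->
  energy (sketch D w) = energy D
    - quadf (rgram D *m rgram D) (sgnv R w) / quadf (rgram D) (sgnv R w).
Proof.
move=> hD; rewrite quadf_rgram// quadf_rgram2// /energy /sketch /deflate.
set x := sgnv R w.
have -> : rgram D *m x = B^T *m (D *m (B *m x)) by rewrite /rgram !mulmxA.
move: (D *m (B *m x)) => z.
rewrite /rgram mulmxBr mulmxBl linearB/=; congr (_ - _).
rewrite -scalemxAr -scalemxAl linearZ/= mulrC; congr (_ * _).
have -> : B^T *m (z *m z^T) *m B = (B^T *m z) *m (B^T *m z)^T.
  by rewrite trmx_mul trmxK !mulmxA.
by rewrite tr_outer.
Qed.

Lemma energy_sketch_le D w : projector D -> energy (sketch D w) <= energy D.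
Proof.
move=> hD; rewrite energy_sketch// quadf_rgram// quadf_rgram2//.
by rewrite gerBl divr_ge0// sqn_ge0.
Qed.

(* The form W = x^T K^2 x - a x^T K x has mean 3T/4 and second moment at most
   51 T^2 / 16, and progress holds wherever W > 0; the indicator of W > 0 is
   bounded below by 2 l W - l^2 W^2 with l = 4 / (17 T). *)
Lemma progress_prob D : projector D ->
  avg (fun w : signs n => (2^-1 : R) ^+ progress D w) <= 11 / 12.
Proof.
move=> hD; set K := rgram D; set F := energy D; set T := fro2 K.
have F0 : 0 <= F by exact: energy_ge0.
have T0 : 0 <= T by exact: fro2_ge0.
have TF : T <= F ^+ 2 by exact: fro2_rgram_le.
have [T_eq0|T_neq0] := eqVneq T 0.
  apply: avg_le_const => [|w]; first lra.
  suff -> : progress D w by rewrite expr1; lra.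
  by rewrite /progress -/K -/T T_eq0 mul0r subr0 energy_sketch_le.
have {T_neq0}T0 : 0 < T by rewrite lt_neqAle eq_sym T_neq0.
have {F0}F0 : 0 < F.
  by rewrite lt_neqAle F0 andbT eq_sym; apply: contraTneq TF => ->; rewrite expr0n/= -ltNge.
pose a := T / (4 * F); pose l := 4 / (17 * T).
have a0 : 0 <= a by rewrite divr_ge0 ?mulr_ge0 ?ltW.
have l0 : 0 <= l by rewrite divr_ge0 ?mulr_ge0 ?ltW.
pose Z w := quadf (K *m K) (sgnv R w); pose Y w := quadf K (sgnv R w).
pose W w := Z w - a * Y w.
have Z0 w : 0 <= Z w by rewrite /Z quadf_rgram2// sqn_ge0.
have Y0 w : 0 <= Y w by rewrite /Y quadf_rgram// sqn_ge0.
have trKK : \tr (K *m K) = T by rewrite /T fro2E rgram_sym.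
have avgZ1 : avg Z = T by rewrite avg_quadf trKK.
have avgY1 : avg Y = F by rewrite avg_quadf.
have avgZ2 : avg (fun w => Z w ^+ 2) <= 3 * T ^+ 2.
  have := avg_quadf2_le (K *m K); rewrite trKK.
  have := fro2M_le K K; rewrite -/T -expr2; rewrite -/(Z _); lra.
have avgY2 : avg (fun w => Y w ^+ 2) <= 3 * F ^+ 2.
  have := avg_quadf2_le K; rewrite -/T -/F; move: TF; lra.
have progressW w : 0 < W w -> progress D w.
  move=> W0; rewrite /progress energy_sketch// -/K -/F -/T lerD2l lerN2.
  rewrite -/(Z w) -/(Y w) -/a.
  have := Y0 w; rewrite le_eqVlt => /predU1P[Yw0|Yw0].
    (* If [x^T K x = 0] then [D B x = 0], hence [K x = 0] and [W] vanishes, against [W > 0]. *)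
    have zE : D *m (B *m sgnv R w) = 0.
      by apply: sqn_eq0; rewrite -quadf_rgram// -/K -/(Y w).
    have Zw0 : Z w = 0.
      rewrite /Z quadf_rgram2// /rgram -!mulmxA zE mulmx0.
      by rewrite /sqn mulmx0 mxE.
    by move: W0; rewrite /W Zw0 -Yw0 mulr0 subr0 ltxx.
  by rewrite ler_pdivlMr//; move: W0; rewrite /W subr_gt0 => /ltW.
apply: (@le_trans _ _ (avg (fun w => 1 + (- l * (Z w) + (l * a * Y w
    + (2^-1 * l ^+ 2 * Z w ^+ 2 + 2^-1 * l ^+ 2 * a ^+ 2 * Y w ^+ 2)))))).
  apply: ler_avg => w.
  have h : 2^-1 * l ^+ 2 * W w ^+ 2 <=
      2^-1 * l ^+ 2 * Z w ^+ 2 + 2^-1 * l ^+ 2 * a ^+ 2 * Y w ^+ 2.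
    have -> : 2^-1 * l ^+ 2 * Z w ^+ 2 + 2^-1 * l ^+ 2 * a ^+ 2 * Y w ^+ 2 =
      2^-1 * l ^+ 2 * W w ^+ 2 + l ^+ 2 * a * (Z w * Y w) by rewrite /W; field.
    by rewrite lerDl mulr_ge0 ?(mulr_ge0 (Z0 w) (Y0 w))// mulr_ge0 ?sqr_ge0.
  apply: (@le_trans _ _ (1 - l * W w + 2^-1 * l ^+ 2 * W w ^+ 2)); last first.
    have -> : 1 + (- l * Z w + (l * a * Y w + (2^-1 * l ^+ 2 * Z w ^+ 2
        + 2^-1 * l ^+ 2 * a ^+ 2 * Y w ^+ 2))) = 1 - l * W w +
        (2^-1 * l ^+ 2 * Z w ^+ 2 + 2^-1 * l ^+ 2 * a ^+ 2 * Y w ^+ 2).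
      by rewrite /W; ring.
    by rewrite lerD2l.
  rewrite -[2^-1 * l ^+ 2 * _]mulrA -exprMn.
  have [W0|W0] := ltP 0 (W w).
    by rewrite progressW// expr1; exact: ge_half_parabola.
  apply: (@le_trans _ _ 1); first by apply: exprn_ile1; rewrite ?invr_ge0// invf_le1// ler1n.
  by apply: ge1_parabola; rewrite mulr_ge0_le0.
rewrite !avgD !avgZ avg_const ?card_signs_gt0// avgZ1 avgY1.
exact: second_moment_bound.
Qed.

End Deflation.

(** * Decay of the residual energy over the successful rounds *)

Section EnergyDecay.
Variable R : realType.

(** Write [a = a^(1 - p/2) * a^(p/2)] and bound the first factor by [a <= t], the second by
    [a <= s^2]. *)
Lemma le_powR_split (p t a s : R) : 1 <= p <= 2 -> 0 <= s -> 0 <= a <= s ^+ 2 -> a <= t ->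
  a <= t `^ (1 - p / 2) * s `^ p.
Proof.
move=> /andP[p1 p2] s0 /andP[a0 as2] le_at.
have [->|an0] := eqVneq a 0; first by rewrite mulr_ge0 ?powR_ge0.
have -> : s `^ p = (s ^+ 2) `^ (p / 2).
  by rewrite -powR_mulrn// -powRrM mulrCA divff ?mulr1// gt_eqF.
have {1}-> : a = a `^ (1 - p / 2) * a `^ (p / 2).
  by rewrite -powRD ?an0 ?implybT// subrK powRr1.
have t0 : 0 <= t by exact: le_trans a0 le_at.
apply: ler_pM; rewrite ?powR_ge0//; apply: ge0_ler_powR; rewrite ?nnegrE ?sqr_ge0//.
  by move: p2; clear; lra.
by move: p1; clear; lra.
Qed.

(** Diagonal entries above [t] satisfy [a <= a^2 / t]; the others are controlled by the singular
    values through [le_powR_split]. *)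
Lemma energy_threshold (n : nat) (p b t : R) (B D : 'M[R]_n) :
  1 <= p <= 2 -> 0 < t -> \sum_i singular_value B i `^ p <= b `^ p -> projector D ->
  energy B D <= fro2 (rgram B D) / t + t `^ (1 - p / 2) * b `^ p.
Proof.
move=> p12 t0 hB hD; have [Dsym DD] := hD.
have [a [ha aE hT]] := compressed_gram_diag B Dsym DD.
rewrite /energy -[\tr _]aE fro2E rgram_sym//.
apply: (@le_trans _ _ (\sum_i (a i ^+ 2 / t
    + t `^ (1 - p / 2) * singular_value B i `^ p))).
  apply: ler_sum => i _; have /andP[a0 _] := ha i.
  have [at'|ta] := leP (a i) t.
    apply: (@le_trans _ _ (t `^ (1 - p / 2) * singular_value B i `^ p)).
      by apply: le_powR_split => //; exact: singular_value_ge0.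
    by rewrite lerDr divr_ge0 ?sqr_ge0// ltW.
  apply: (@le_trans _ _ (a i ^+ 2 / t)).
    by rewrite ler_pdivlMr// expr2 ler_wpM2l// ltW.
  by rewrite lerDl mulr_ge0 ?powR_ge0.
rewrite big_split/= -mulr_suml -mulr_sumr; apply: lerD.
  by rewrite ler_wpM2r ?invr_ge0 ?(ltW t0).
by rewrite ler_wpM2l ?powR_ge0.
Qed.

(** Every singular value is at most [b], so [le_powR_split] applies with [t = b^2]; in effect the
    Frobenius norm is at most the Schatten norm for [p <= 2]. *)
Lemma energy1_le (n : nat) (p b : R) (B : 'M[R]_n) :
  1 <= p <= 2 -> 0 < b -> \sum_i singular_value B i `^ p <= b `^ p ->
  energy B 1%:M <= b ^+ 2.
Proof.
move=> p12 b0 hB; have [Dsym DD] := projector1 R n.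
have [a [ha aE _]] := compressed_gram_diag B Dsym DD.
rewrite /energy /rgram -aE.
have p0 : 0 < p by case/andP: p12 => p1 _; exact: lt_le_trans ltr01 p1.
have sb i : singular_value B i <= b.
  rewrite leNgt; apply/negP => lt_bs.
  have : b `^ p < singular_value B i `^ p.
    by apply: gt0_ltr_powR => //; rewrite nnegrE ?singular_value_ge0// ltW.
  rewrite ltNge => /negP; apply; apply: le_trans hB.
  by rewrite (bigD1 i)//= lerDl sumr_ge0// => j _; exact: powR_ge0.
have b2E : (b ^+ 2) `^ (1 - p / 2) * b `^ p = b ^+ 2.
  have -> : b `^ p = (b ^+ 2) `^ (p / 2).
    by rewrite -powR_mulrn ?(ltW b0)// -powRrM mulrCA divff ?mulr1// gt_eqF.
  rewrite -powRD ?subrK ?powRr1 ?sqr_ge0//.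
  by apply/implyP => _; rewrite expf_neq0// gt_eqF.
apply: (@le_trans _ _ (\sum_i (b ^+ 2) `^ (1 - p / 2) * singular_value B i `^ p)).
  apply: ler_sum => i _; apply: le_powR_split => //; first exact: singular_value_ge0.
  have /andP[_ h] := ha i; apply: le_trans h _.
  by rewrite lerXn2r// nnegrE ?singular_value_ge0// ltW.
by rewrite -mulr_sumr -[leRHS]b2E ler_wpM2l ?powR_ge0.
Qed.

(** Envelope for the energy after [g] successful rounds, of order [b^2 g^(1 - 2/p)]. The slope
    [1/20] is small enough for one round of progress to cover one step of the envelope. *)
Definition decay (p b : R) (g : nat) : R :=
  2 * b ^+ 2 * (1 + g%:R / 20) `^ (- (2 / p - 1)).

(** As [th <= 1], the ratio of the two powers is at most [z / (z - 1/20)], hence at most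
    [1 + 1 / (16 z)]. *)
Lemma powRN_shift_le (th z : R) : 0 <= th <= 1 -> 21 / 20 <= z ->
  (z - 20^-1) `^ (- th) <= z `^ (- th) + z `^ (- th) / z / 16.
Proof.
move=> /andP[th0 th1] hz.
have z0 : 0 < z by move: hz; clear; lra.
have y0 : 0 < z - 20^-1 by move: hz; clear; lra.
have q0 : 0 < z `^ (- th) by rewrite powR_gt0.
have -> : (z - 20^-1) `^ (- th) = z `^ (- th) * (z / (z - 20^-1)) `^ th.
  by rewrite powR_div ?(ltW z0)// !powRN mulrA mulVf ?mul1r// gt_eqF// powR_gt0.
have h1 : (z / (z - 20^-1)) `^ th <= z / (z - 20^-1).
  by apply: ler1_powR => //; rewrite ler_pdivlMr// mul1r; clear; lra.
apply: le_trans (ler_wpM2l (ltW q0) h1) _.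
have -> : z `^ (- th) + z `^ (- th) / z / 16 = z `^ (- th) * (1 + 1 / (16 * z)).
  by field; rewrite gt_eqF.
rewrite ler_wpM2l ?(ltW q0)// ler_pdivrMr//.
have -> : (1 + 1 / (16 * z)) * (z - 20^-1) = z + (1 / 80 - 1 / (320 * z)).
  by field; rewrite gt_eqF.
rewrite lerDl subr_ge0 ler_pdivrMr ?mulr_gt0//; move: hz; clear; lra.
Qed.

Lemma decay_nonincr (p b : R) (g g' : nat) : 1 <= p <= 2 -> (g <= g')%N ->
  decay p b g' <= decay p b g.
Proof.
move=> /andP[p1 p2] gg'; rewrite /decay ler_wpM2l ?(mulr_ge0 _ (sqr_ge0 b))//.
have hg : 0 < 1 + g%:R / 20 :> R by rewrite ltr_wpDr// divr_ge0.
have hg' : 1 + g%:R / 20 <= 1 + g'%:R / 20 :> R by rewrite lerD2l ler_wpM2r// ler_nat.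
have h0 := lt_le_trans hg hg'.
rewrite !powRN lef_pV2 ?posrE ?powR_gt0//.
apply: ge0_ler_powR; rewrite ?nnegrE ?(ltW hg) ?(ltW h0)//.
rewrite subr_ge0 ler_pdivlMr ?mul1r//; exact: lt_le_trans ltr01 p1.
Qed.

(** Unless the energy [F] is already below the next value of the envelope, the threshold bound gives
    [F / 2 <= T / t], so progress removes at least [t / 8]; the envelope falls by no more than
    that. *)
Lemma energy_progress_le (n : nat) (p b : R) (B D : 'M[R]_n) (w : signs n) (g : nat) :
  1 <= p <= 2 -> 0 < b -> \sum_i singular_value B i `^ p <= b `^ p -> projector D ->
  energy B D <= decay p b g -> progress B D w ->
  energy B (sketch B D w) <= decay p b g.+1.
Proof.
move=> p12 b0 hB hD hF hprog.
have [hle|hlt] := leP (energy B D) (decay p b g.+1).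
  exact: le_trans (energy_sketch_le B w hD) hle.
have /andP[p1 p2] := p12; have p0 : 0 < p by exact: lt_le_trans ltr01 p1.
pose z : R := 1 + g.+1%:R / 20; pose th := 2 / p - 1.
have zE : 1 + g%:R / 20 = z - 20^-1 by rewrite /z -natr1; field.
have z1 : 21 / 20 <= z by rewrite /z -natr1; have : 0 <= g%:R :> R by []; clear; lra.
have z0 : 0 < z by move: z1; clear; lra.
have th01 : 0 <= th <= 1.
  rewrite /th subr_ge0 ler_pdivlMr ?mul1r// p2/= lerBlDr ler_pdivrMr//.
  by move: p1; clear; lra.
pose q := z `^ (- th); have q0 : 0 < q by rewrite powR_gt0.
(* This [t] makes [t^(1 - p/2) * b^p] equal to [b^2 q], half of [decay p b g.+1]. *)
pose t := b ^+ 2 * (q / z); have t0 : 0 < t by rewrite mulr_gt0 ?exprn_gt0 ?divr_gt0.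
have qz : q / z = z `^ (- (2 / p)).
  have -> : - (2 / p) = - th + - 1 by rewrite /th; ring.
  by rewrite powRD ?(gt_eqF z0) ?implybT// powR_inv1 ?(ltW z0).
have tb : t `^ (1 - p / 2) * b `^ p = b ^+ 2 * q.
  rewrite /t powRM ?sqr_ge0 ?divr_ge0 ?(ltW q0) ?(ltW z0)// qz -powRrM mulrAC.
  have -> : - (2 / p) * (1 - p / 2) = - th by rewrite /th; field; rewrite gt_eqF.
  congr (_ * _).
  have -> : b `^ p = (b ^+ 2) `^ (p / 2).
    by rewrite -powR_mulrn ?(ltW b0)// -powRrM mulrCA divff ?mulr1// gt_eqF.
  rewrite -powRD ?subrK ?powRr1 ?sqr_ge0//.
  by apply/implyP => _; rewrite expf_neq0// gt_eqF.
have := energy_threshold p12 t0 hB hD; rewrite tb.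
move: hF hlt hprog; rewrite /progress /decay zE -/z -/th -/q.
have := powRN_shift_le th01 z1; rewrite -/q.
move: (energy B D) (energy B (sketch B D w)) (fro2 (rgram B D)) => F F' T.
move: ((z - 20^-1) `^ (- th)) => q' hq hF hlt hF' hT.
have F0 : 0 < F by apply: lt_trans hlt; rewrite !mulr_gt0 ?exprn_gt0.
have hT2 : t / 8 <= T / (4 * F).
  rewrite ler_pdivlMr ?mulr_gt0//.
  have : F / 2 <= T / t by move: hT hlt; clear; lra.
  by rewrite ler_pdivlMr//; move: F0 t0; clear; lra.
apply: le_trans hF' _.
have : b ^+ 2 * q' <= b ^+ 2 * (q + q / z / 16) by rewrite ler_wpM2l ?sqr_ge0.
rewrite mulrDr mulrA -/t; move: hT2 hF; rewrite /t.
clear; move: (q / z) => r; lra.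
Qed.

Lemma energy_run_le (n : nat) (p b : R) (B : 'M[R]_n) (ws : seq (signs n))
    (D : 'M[R]_n) (g : nat) :
  1 <= p <= 2 -> 0 < b -> \sum_i singular_value B i `^ p <= b `^ p -> projector D ->
  energy B D <= decay p b g ->
  energy B (foldl (sketch B) D ws) <=
    decay p b (g + runcount (sketch B) (progress B) D ws).
Proof.
move=> p12 b0 hB; elim: ws D g => [|w ws IHws] D g hD hF /=; first by rewrite addn0.
have hD' : projector (sketch B D w) by exact: deflate_projector.
rewrite addnA; apply: IHws => //; case: (boolP (progress B D w)) => [hp|_].
  by rewrite addn1; exact: energy_progress_le hD hF hp.
by rewrite addn0; exact: le_trans (energy_sketch_le B w hD) hF.
Qed.

End EnergyDecay.

(** * Programs that query a single matrix *)

Section QueryPrograms.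
Variables (R : realType) (n : nat).

(** The matrix is left implicit: it will be an input or a difference of two inputs. Indices and
    timing enter only on translation to [online_alg]. *)
Inductive qtree := QRet of R | QAsk of 'cV[R]_n & ('cV[R]_n -> qtree).

Fixpoint qeval (B : 'M[R]_n) (t : qtree) : R :=
  match t with QRet r => r | QAsk x k => qeval B (k (B *m x)) end.

Fixpoint qcost (B : 'M[R]_n) (t : qtree) : nat :=
  match t with QRet _ => 0 | QAsk x k => (qcost B (k (B *m x))).+1 end.

Fixpoint ask (xs : seq 'cV[R]_n) (k : seq 'cV[R]_n -> qtree) : qtree :=
  if xs is x :: xs' then QAsk x (fun y => ask xs' (fun ys => k (y :: ys)))
  else k [::].

Fixpoint asks (xss : seq (seq 'cV[R]_n)) (k : seq (seq 'cV[R]_n) -> qtree) : qtree :=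
  if xss is xs :: xss' then ask xs (fun ys => asks xss' (fun yss => k (ys :: yss)))
  else k [::].

Lemma qeval_ask B xs k : qeval B (ask xs k) = qeval B (k (map (mulmx B) xs)).
Proof. by elim: xs k => [|x xs IHxs] k //=; rewrite IHxs. Qed.

Lemma qcost_ask B xs k :
  qcost B (ask xs k) = (size xs + qcost B (k (map (mulmx B) xs)))%N.
Proof. by elim: xs k => [|x xs IHxs] k //=; rewrite IHxs. Qed.

Lemma qeval_asks B xss k :
  qeval B (asks xss k) = qeval B (k (map (map (mulmx B)) xss)).
Proof. by elim: xss k => [|xs xss IH] k //=; rewrite qeval_ask IH. Qed.

Lemma qcost_asks B xss k :
  qcost B (asks xss k) = (sumn (map size xss) + qcost B (k (map (map (mulmx B)) xss)))%N.
Proof. by elim: xss k => [|xs xss IH] k //=; rewrite qcost_ask IH addnA. Qed.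

(** Unnormalised Gram-Schmidt: the residual of each [y] after projecting out the earlier ones. *)
Fixpoint dirs (D : 'M[R]_n) (ys : seq 'cV[R]_n) : seq 'cV[R]_n :=
  if ys is y :: ys' then D *m y :: dirs (deflate D y) ys' else [::].

Lemma size_dirs D ys : size (dirs D ys) = size ys.
Proof. by elim: ys D => [|y ys IH] D //=; rewrite IH. Qed.

Definition captured (zs ws : seq 'cV[R]_n) : R :=
  \sum_(q <- zip zs ws) (sqn q.1)^-1 * (q.1^T *m q.2) 0 0.

(** Telescoping: each deflation removes [z z^T / |z|^2], whose product with [B] has trace
    [z^T B z / |z|^2]. A zero residual contributes 0 on both sides, as [0^-1 = 0]. *)
Lemma trace_split (B D : 'M[R]_n) (ys : seq 'cV[R]_n) :
  \tr (D *m B) = captured (dirs D ys) (map (mulmx B) (dirs D ys))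
                 + \tr (foldl (@deflate R n) D ys *m B).
Proof.
rewrite /captured; elim: ys D => [|y ys IH] D /=; first by rewrite big_nil add0r.
rewrite big_cons -addrA -IH /deflate /= mulmxBl linearB/= -scalemxAl linearZ/=.
have -> : \tr (D *m y *m (D *m y)^T *m B) = ((D *m y)^T *m (B *m (D *m y))) 0 0.
  by move: (D *m y) => z; rewrite -mulmxA mxtrace_mulC -mulmxA trace_mx11.
by rewrite addrC subrK.
Qed.

Definition group_est (D : 'M[R]_n) (xs ys : seq 'cV[R]_n) : R :=
  (\sum_(q <- zip xs ys) (q.1^T *m D *m q.2) 0 0) / (size xs)%:R.

Definition close_to (rho z : R) : pred R := fun e => `|e - z| <= rho.

(** Plays the role of a median: some point within [rho] of more than half of the values, or 0 if
    there is none. *)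
Definition majority (rho : R) (es : seq R) : R :=
  xget 0 [set z | (size es < 2 * count (close_to rho z) es)%N].

(** Two strict majorities share a value, which is within [rho] of both centres. *)
Lemma majorityP rho es t :
  (size es < 2 * count (close_to rho t) es)%N ->
  `|majority rho es - t| <= 2 * rho.
Proof.
move=> ht; rewrite /majority; case: xgetP => [z _ /= hz|/(_ t)//].
have : has (predI (close_to rho z) (close_to rho t)) es.
  rewrite has_count.
  have := count_predUI (close_to rho z) (close_to rho t) es.
  have := count_size (predU (close_to rho z) (close_to rho t)) es.
  move: hz ht.
  move: (count _ es) (count _ es) (count _ es) (count _ es) => c1 c2 c3 c4; lia.
rewrite /close_to => /hasP[e _ /= /andP[h1 h2]].
have -> : z - t = (z - e) + (e - t) by rewrite addrA subrK.
by apply: le_trans (ler_normD _ _) _; rewrite mulr_natl mulr2n lerD// distrC.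
Qed.

(** Three batches of queries: sign vectors for the sketch, the residual directions for the exact
    part of the trace, and fresh groups of sign vectors for the remainder. *)
Definition est_prog (rho : R) (ws : seq (signs n)) (gs : seq (seq (signs n))) : qtree :=
  ask (map (@sgnv R n) ws) (fun ys =>
  ask (dirs 1%:M ys) (fun bs =>
  asks (map (map (@sgnv R n)) gs) (fun yss =>
  QRet (captured (dirs 1%:M ys) bs + majority rho
    [seq group_est (foldl (@deflate R n) 1%:M ys) q.1 q.2
    | q <- zip (map (map (@sgnv R n)) gs) yss])))).

Definition hutch (G : 'M[R]_n) (ws : seq (signs n)) : R :=
  (\sum_(w <- ws) quadf G (sgnv R w)) / (size ws)%:R.

Lemma group_estE (B D : 'M[R]_n) (ws : seq (signs n)) :
  group_est D (map (@sgnv R n) ws) (map (mulmx B) (map (@sgnv R n) ws)) = hutch (D *m B) ws.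
Proof.
rewrite /group_est /hutch size_map; congr (_ / _).
elim: ws => [|w ws IH] /=; first by rewrite !big_nil.
by rewrite !big_cons IH /quadf /= !mulmxA.
Qed.

Lemma qcost_est_prog B rho ws gs :
  qcost B (est_prog rho ws gs) = (2 * size ws + sumn (map size gs))%N.
Proof.
rewrite /est_prog qcost_ask qcost_ask qcost_asks /= size_dirs !size_map addn0.
rewrite -map_comp addnA mul2n addnn; congr (_ + sumn _)%N.
by apply: eq_map => g /=; rewrite size_map.
Qed.

Lemma qeval_est_prog B rho ws gs :
  let D := foldl (sketch B) 1%:M ws in
  qeval B (est_prog rho ws gs) - \tr B =
  majority rho (map (hutch (D *m B)) gs) - \tr (D *m B).
Proof.
move=> D; rewrite /est_prog qeval_ask qeval_ask qeval_asks /=.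
set ys := map (mulmx B) _.
have DE : foldl (@deflate R n) 1%:M ys = D.
  by rewrite /ys /D -map_comp; elim: (ws) (1%:M) => //= w ws' IH D'; rewrite IH.
have := trace_split B 1%:M ys; rewrite mul1mx DE => ->.
rewrite opprD addrACA subrr add0r; congr (majority rho _ - _).
elim: gs => [|g gs IH] //=; rewrite group_estE; congr cons.
by rewrite -IH.
Qed.

End QueryPrograms.

(** * Failure probability and cost of the estimator for one matrix *)

Section StaticEstimator.
Variable R : realType.

Lemma avg_sum_tuple (S : finType) (N : nat) (f : S -> R) : (0 < #|S|)%N -> avg f = 0 ->
  avg (fun t : N.-tuple S => \sum_(x <- t) f x) = 0.
Proof.
move=> S0 f0; elim: N => [|N IHN]; first by rewrite avg_tuple0 big_nil.
rewrite avg_tupleS (eq_avg (g := f)) ?f0// => x /=.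
under eq_avg do rewrite big_cons.
by rewrite avgD IHN addr0 avg_const// card_tuple expn_gt0 S0.
Qed.

(** The cross terms vanish, the samples being independent and centred. *)
Lemma avg_sqr_sum_tuple (S : finType) (N : nat) (f : S -> R) (v : R) :
  (0 < #|S|)%N -> avg f = 0 -> avg (fun x => f x ^+ 2) <= v ->
  avg (fun t : N.-tuple S => (\sum_(x <- t) f x) ^+ 2) <= N%:R * v.
Proof.
move=> S0 f0 hv; elim: N => [|N IHN].
  by rewrite avg_tuple0 big_nil expr0n/= mul0r.
rewrite avg_tupleS -natr1 mulrDl mul1r addrC.
rewrite (eq_avg (g := fun x => f x ^+ 2
    + avg (fun t : N.-tuple S => (\sum_(x <- t) f x) ^+ 2))); last first.
  move=> x /=.
  transitivity (avg (fun t : N.-tuple S => f x ^+ 2 + (2 * f x * (\sum_(y <- t) f y)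
      + (\sum_(y <- t) f y) ^+ 2))).
    by apply: eq_avg => t; rewrite big_cons; ring.
  by rewrite !avgD avgZ avg_sum_tuple// mulr0 add0r avg_const// card_tuple expn_gt0 S0.
by rewrite avgD avg_const// lerD.
Qed.

(** Chebyshev's inequality for the mean of [k] quadratic forms, each of variance at most
    [2 * fro2 G]. *)
Lemma hutch_fail (n k : nat) (G : 'M[R]_n) (rho eta : R) : (0 < k)%N -> 0 < rho ->
  2 * fro2 G <= eta * k%:R * rho ^+ 2 ->
  pr R (fun t : k.-tuple (signs n) => ~~ close_to rho (\tr G) (hutch G t)) <= eta.
Proof.
move=> k0 rho0 hG; have k0' : 0 < k%:R :> R by rewrite ltr0n.
pose f w := quadf G (sgnv R w) - \tr G.
have f0 : avg f = 0.
  by rewrite /f avgD avg_quadf avg_const ?subrr// card_signs_gt0.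
have S0 := card_signs_gt0 n.
have hv := avg_sqr_sum_tuple k S0 f0 (avg_quadf_var_le G).
pose c := (k%:R * rho) ^- 2.
have c0 : 0 <= c by rewrite invr_ge0 sqr_ge0.
apply: (@le_trans _ _ (avg (fun t : k.-tuple (signs n) => c * (\sum_(x <- t) f x) ^+ 2))).
  apply: pr_le_avg => t; first by rewrite mulr_ge0 ?sqr_ge0.
  rewrite /close_to -ltNge => ht.
  have sumE : \sum_(x <- t) f x = k%:R * (hutch G t - \tr G).
    rewrite /hutch size_tuple mulrBr mulrCA divff ?gt_eqF// mulr1.
    rewrite /f big_split/= big_const_seq count_predT size_tuple iter_addr addr0.
    by rewrite mulr_natl mulNrn.
  rewrite sumE /c; move: (hutch G t - \tr G) ht => y ht.
  have -> : (k%:R * rho) ^- 2 * (k%:R * y) ^+ 2 = y ^+ 2 / rho ^+ 2.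
    by field; rewrite !gt_eqF.
  rewrite ler_pdivlMr ?exprn_gt0// mul1r -[leRHS]real_normK ?num_real//.
  by rewrite lerXn2r ?nnegrE ?(ltW rho0) ?(ltW ht).
rewrite avgZ; apply: le_trans (ler_wpM2l c0 hv) _.
rewrite /c mulrC ler_pdivrMr ?exprn_gt0 ?mulr_gt0// exprMn.
have -> : eta * (k%:R ^+ 2 * rho ^+ 2) = k%:R * (eta * k%:R * rho ^+ 2) by ring.
by rewrite ler_wpM2l ?(ltW k0').
Qed.

(** A group is bad with probability at most [1/16], and failure requires at least [h] bad groups
    among [2h]. Chernoff's bound with base 16 has factor at most [1 + 15/16 <= 2] per group, giving
    [2^(2h) / 16^h]. *)
Lemma majority_fail (n h k : nat) (G : 'M[R]_n) (rho : R) : (0 < k)%N -> 0 < rho ->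
  32 * fro2 G <= k%:R * rho ^+ 2 ->
  pr R (fun ts : (2 * h).-tuple (k.-tuple (signs n)) =>
    ~~ (`|majority rho (map (hutch G) (map val ts)) - \tr G| <= 2 * rho)) <= 4^-1 ^+ h.
Proof.
move=> k0 rho0 hG.
pose bad (t : k.-tuple (signs n)) := ~~ close_to rho (\tr G) (hutch G t).
have hbad : pr R bad <= 16^-1.
  apply: hutch_fail => //; rewrite -mulrA; move: hG.
  by move: (k%:R * _) (fro2 G) => u v; clear; lra.
pose S := k.-tuple (signs n).
have S0 : (0 < #|{: S}|)%N by rewrite card_tuple expn_gt0 card_signs_gt0.
pose stp (z : unit) (x : S) := z.
pose hit (z : unit) (x : S) := bad x.
have cntE (ts : seq S) : runcount stp hit tt ts = count bad ts.
  by elim: ts => //= t ts ->.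
have havg : avg (fun ts : (2 * h).-tuple S => (16 : R) ^+ runcount stp hit tt ts) <= 2 ^+ (2 * h).
  apply: (avg_exp_runcount (Inv := fun=> True)) => // -[] _.
  apply: (@le_trans _ _ (avg (fun x : S => 1 + 15 * (bad x)%:R))).
    apply: ler_avg => x; rewrite /hit; case: (bad x); rewrite /= ?expr0 ?expr1; clear; lra.
  rewrite avgD avgZ avg_const//; move: hbad; rewrite /pr; lra.
have c0 : 0 <= 16^-1 ^+ h :> R by rewrite exprn_ge0.
apply: (@le_trans _ _ (avg (fun ts : (2 * h).-tuple S =>
    16^-1 ^+ h * (16 : R) ^+ runcount stp hit tt ts))).
  apply: pr_le_avg => ts; first by rewrite mulr_ge0// exprn_ge0.
  move=> hts; have hc : (h <= count bad ts)%N.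
    rewrite leqNgt; apply/negP => hc; move/negP: hts; apply; apply: majorityP.
    rewrite size_map size_map size_tuple -map_comp count_map.
    have := count_predC bad ts; rewrite size_tuple.
    rewrite (_ : count (predC bad) ts =
      count (preim (hutch G \o val) (close_to rho (\tr G))) ts); last first.
      by apply: eq_count => t; rewrite /bad/= negbK.
    by move: hc; move: (count (preim _ _) ts) (count bad ts) => c2 c1; clear; lia.
  rewrite cntE -(subnKC hc) exprD mulrA -exprMn mulVf ?pnatr_eq0// expr1n mul1r.
  by apply: exprn_ege1; rewrite ler1n.
rewrite avgZ; apply: le_trans (ler_wpM2l c0 havg) _.
rewrite exprM -exprMn; apply: lerXn2r; rewrite ?nnegrE; lra.
Qed.

(** Chernoff's bound with base [1/2]: since [(11/12)^8 <= 1/2], sixteen rounds per required success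
    give [2 * (11/12)^16 <= 1/2]. *)
Lemma sketch_fail (n g : nat) (B : 'M[R]_n) :
  pr R (fun ts : (16 * g).-tuple (signs n) =>
    (runcount (sketch B) (progress B) 1%:M ts < g)%N) <= 2^-1 ^+ g.
Proof.
have havg : avg (fun ts : (16 * g).-tuple (signs n) =>
    (2^-1 : R) ^+ runcount (sketch B) (progress B) 1%:M ts) <= (11 / 12) ^+ (16 * g).
  apply: (avg_exp_runcount (Inv := @projector R n)) => //; last exact: projector1.
  - by move=> D w; exact: deflate_projector.
  - exact: progress_prob.
apply: (@le_trans _ _ (avg (fun ts : (16 * g).-tuple (signs n) =>
    2 ^+ g * (2^-1 : R) ^+ runcount (sketch B) (progress B) 1%:M ts))).
  apply: pr_le_avg => ts; first by rewrite mulr_ge0// exprn_ge0.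
  move: (runcount _ _ _ _) => c {havg ts} hts; rewrite -(subnKC (ltnW hts)).
  rewrite [leRHS]mulrC exprD mulrA -exprMn.
  by rewrite mulVf ?pnatr_eq0// expr1n mul1r exprn_ege1// ler1n.
rewrite avgZ; apply: le_trans (ler_wpM2l _ havg) _; first by rewrite exprn_ge0.
rewrite exprM -exprMn; apply: lerXn2r; rewrite ?nnegrE ?invr_ge0//.
have h8 : ((11 / 12) ^+ 8 : R) <= 2^-1 by clear; lra.
have h0 : 0 <= ((11 / 12) ^+ 8 : R) by rewrite exprn_ge0// divr_ge0.
rewrite -[16%N]/(8 * 2)%N exprM expr2; move: h8 h0; move: (_ ^+ 8) => u; clear; nra.
Qed.

(** The majority is taken with [rho = eps / 2], so [majority_fail] needs [32 F <= k (eps / 2)^2],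
    which explains 128. The [16 g] sketch queries are doubled by those along the residual
    directions. *)
Lemma static_estimator (n g h k : nat) (p b eps : R) :
  1 <= p <= 2 -> 0 < b -> 0 < eps -> (0 < k)%N ->
  128 * decay p b g <= k%:R * eps ^+ 2 ->
  exists (S : finType) (prog : S -> qtree R n),
    [/\ (0 < #|S|)%N,
        forall B s, qcost B (prog s) = (32 * g + 2 * h * k)%N &
        forall B, schatten_norm p B <= b ->
          pr R (fun s => ~~ (`|qeval B (prog s) - \tr B| <= eps)) <= 2^-1 ^+ g + 4^-1 ^+ h].
Proof.
move=> p12 b0 eps0 k0 hdec.
exists ((16 * g).-tuple (signs n) * (2 * h).-tuple (k.-tuple (signs n)))%type.
exists (fun s : (16 * g).-tuple (signs n) * (2 * h).-tuple (k.-tuple (signs n)) =>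
  est_prog (eps / 2) s.1 (map val s.2)); split.
- by rewrite card_prod !card_tuple muln_gt0 !expn_gt0 ?expn_gt0 card_signs_gt0.
- move=> B [ws gs]; rewrite qcost_est_prog size_tuple /= mulnA; congr (_ + _)%N.
  rewrite -map_comp (_ : map _ gs = nseq (2 * h) k) ?sumn_nseq 1?mulnC//.
  rewrite -[in RHS](size_tuple gs); elim: (val gs) => //= g' gs' ->.
  by rewrite size_tuple.
- move=> B hB.
  have hB' : \sum_i singular_value B i `^ p <= b `^ p.
    by apply: eqbLR (schatten_norm_le B _ b0) hB; case/andP: p12.
  rewrite /pr avg_pair.
  apply: (@le_trans _ _ (avg (fun ts : (16 * g).-tuple (signs n) =>
    (runcount (sketch B) (progress B) 1%:M ts < g)%N%:R + 4^-1 ^+ h))); last first.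
    rewrite avgD avg_const ?lerD2r; last by rewrite card_tuple expn_gt0 card_signs_gt0.
    exact: sketch_fail.
  apply: ler_avg => ws; have c0 : 0 <= 4^-1 ^+ h :> R by rewrite exprn_ge0.
  case: ltnP => hcnt.
    by apply: le_trans (pr_le1 R _) _; rewrite lerDl.
  rewrite add0r; pose D := foldl (sketch B) 1%:M ws.
  have hD : projector D.
    rewrite /D; elim: (val ws) (1%:M) (projector1 R n) => //= w ws' IH D' hD'.
    by apply: IH; exact: deflate_projector.
  have hE : energy B D <= decay p b g.
    apply: (@le_trans _ _ (decay p b (0 + runcount (sketch B) (progress B) 1%:M ws))).
      apply: energy_run_le => //; first exact: projector1.
      apply: le_trans (energy1_le p12 b0 hB') _.
      rewrite /decay mul0r addr0 powR1 mulr1; have := sqr_ge0 b.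
      by move: (b ^+ 2) => u; clear; lra.
    exact: decay_nonincr.
  have hf : 32 * fro2 (D *m B) <= k%:R * (eps / 2) ^+ 2.
    rewrite -energyE//; move: hE hdec; rewrite exprMn.
    move: (energy B D) (decay p b g) (eps ^+ 2) (k%:R : R) => u v e K; clear.
    rewrite mulrA; move: (K * e) => r; lra.
  have eps2 : 0 < eps / 2 by rewrite divr_gt0.
  apply: le_trans (majority_fail h k0 eps2 hf).
  apply: pr_sub => gs /=; rewrite qeval_est_prog -/D.
  by rewrite [2 * (eps / 2)]mulrC divfK.
Qed.

End StaticEstimator.

(** * Choice of the sample sizes *)

Section SampleSizes.
Variable R : realType.

Lemma nat_ceil (x : R) : 0 <= x -> exists N : nat, x <= N%:R <= x + 1 /\ (0 < N)%N.
Proof.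
move=> x0; exists (Num.truncn x).+1; split=> //.
have /andP[h1 h2] := Num.Theory.truncn_itv x0.
by rewrite (ltW h2)/= -natr1 lerD2r.
Qed.

Lemma ln2_ge_half : 2^-1 <= ln (2 : R).
Proof.
have : ln (1 + - 2^-1 : R) <= - 2^-1 by apply: le_ln1Dx; clear; lra.
have -> : 1 + - 2^-1 = 2^-1 :> R by field.
by rewrite lnV ?posrE// lerN2.
Qed.

Lemma half_exp_le (x : R) (h : nat) : 0 <= x -> 1 + 2 * x <= h%:R ->
  2^-1 ^+ h <= expR (- x) / 2.
Proof.
move=> x0 hx; have e2 : 2^-1 = expR (- ln 2) :> R by rewrite expRN lnK// posrE.
rewrite [in leLHS]e2 -expRM_natl; have -> : expR (- x) / 2 = expR (- x - ln 2).
  by rewrite expRB lnK// posrE.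
rewrite ler_expR.
have h1 : 0 <= h%:R - 1 :> R by move: hx x0; clear; lra.
have := ler_wpM2l h1 ln2_ge_half; move: hx; clear; move: (ln 2) => l; lra.
Qed.

(** Put [Y = b sqrt(Lam) / eps], so that [b^2 = eps^2 Y^2 / Lam] and [X = Y^p]. For [Y >= 1] use
    [X = Y^2 X^(- th)] and [X <= m]; for [Y < 1] use [Y^2 <= Y^p]. *)
Lemma decay_le (p b eps Lam : R) (X := (b * Num.sqrt Lam / eps) `^ p) (g : nat) :
  1 <= p <= 2 -> 0 < b -> 0 < eps -> 0 < Lam -> 20 * X <= g%:R ->
  decay p b g <= 2 * (eps ^+ 2 * X / Lam).
Proof.
move=> /andP[p1 p2] b0 e0 L0 hg.
have p0 : 0 < p by exact: lt_le_trans ltr01 p1.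
pose Y := b * Num.sqrt Lam / eps.
have Y0 : 0 < Y by rewrite divr_gt0// mulr_gt0// sqrtr_gt0.
have b2 : b ^+ 2 = eps ^+ 2 * Y ^+ 2 / Lam.
  rewrite /Y exprMn exprMn sqr_sqrtr ?(ltW L0)//; field; rewrite !gt_eqF//.
rewrite /decay b2 -[2 * _ * _]mulrA ler_wpM2l//.
have -> : eps ^+ 2 * X / Lam = eps ^+ 2 / Lam * X by ring.
have -> (M : R) : eps ^+ 2 * Y ^+ 2 / Lam * M = eps ^+ 2 / Lam * (Y ^+ 2 * M) by ring.
rewrite ler_wpM2l ?divr_ge0 ?sqr_ge0 ?(ltW L0)//.
pose m : R := 1 + g%:R / 20; rewrite -/m.
pose th := 2 / p - 1; rewrite -/th.
have th0 : 0 <= th by rewrite subr_ge0 ler_pdivlMr ?mul1r.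
have m1 : 1 <= m by rewrite lerDl divr_ge0.
have mX : X <= m by rewrite /m; move: hg; clear; lra.
have m0 : 0 < m by exact: lt_le_trans ltr01 m1.
have [Y1|Y1] := leP 1 Y.
  have X1 : 0 < X by rewrite powR_gt0.
  have -> : X = Y ^+ 2 * X `^ (- th).
    rewrite /X -/Y -powR_mulrn ?(ltW Y0)// -powRrM -powRD ?(gt_eqF Y0) ?implybT//.
    by congr powR; rewrite /th; field; rewrite gt_eqF.
  rewrite ler_wpM2l ?sqr_ge0// !powRN lef_pV2 ?posrE ?powR_gt0//.
  by apply: ge0_ler_powR; rewrite ?nnegrE ?(ltW X1) ?(ltW m0).
have hm : m `^ (- th) <= 1.
  rewrite powRN invf_le1 ?powR_gt0// -[leLHS](powRr0 m); exact: ler_powR.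
apply: (@le_trans _ _ (Y ^+ 2)); first by rewrite ler_piMr ?sqr_ge0.
rewrite -powR_mulrn ?(ltW Y0)// /X; apply: ger_powR => //; by rewrite Y0 (ltW Y1).
Qed.

Lemma static_queries : exists K : R, 0 < K /\
  forall (n : nat) (p b eps Lam : R),
  1 <= p <= 2 -> 0 < b -> 0 < eps -> 1 <= Lam ->
  exists (S : finType) (prog : S -> qtree R n),
    [/\ (0 < #|S|)%N,
        forall B s, (qcost B (prog s))%:R <= K * ((b * Num.sqrt Lam / eps) `^ p + Lam) &
        forall B, schatten_norm p B <= b ->
          pr R (fun s => ~~ (`|qeval B (prog s) - \tr B| <= eps)) <= expR (- Lam)].
Proof.
(* [2688 = 32 * 20 + 2 * 4 * 256], the coefficient of [X] in the cost below. *)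
exists 2688; split=> [|n p b eps Lam p12 b0 e0 L1]; first by rewrite ltr0n.
set X := (b * Num.sqrt Lam / eps) `^ p.
 have L0 : 0 < Lam by exact: lt_le_trans ltr01 L1.
have X0 : 0 <= X by exact: powR_ge0.
have [h [/andP[h1 h2] _]] : exists N : nat, 1 + 2 * Lam <= N%:R <= 1 + 2 * Lam + 1 /\ (0 < N)%N.
  by apply: nat_ceil; move: L0; clear; lra.
have [g [/andP[g1 g2] _]] : exists N : nat, 20 * X <= N%:R <= 20 * X + 1 /\ (0 < N)%N.
  by apply: nat_ceil; rewrite mulr_ge0.
have [k [/andP[k1 k2] k0]] :
    exists N : nat, 256 * (X / Lam) <= N%:R <= 256 * (X / Lam) + 1 /\ (0 < N)%N.
  by apply: nat_ceil; rewrite mulr_ge0// divr_ge0// ltW.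
(* Taking [h + g] successes instead of [g] also makes the failure of the sketch at most
   [2^(- h)]. *)
have hdec : 128 * decay p b (h + g) <= k%:R * eps ^+ 2.
  have : decay p b (h + g) <= 2 * (eps ^+ 2 * X / Lam).
    apply: decay_le => //; rewrite natrD; apply: le_trans g1 _.
    by rewrite lerDr ler0n.
  have := ler_wpM2r (sqr_ge0 eps) k1; rewrite -[eps ^+ 2 * X / Lam]mulrA.
  move: (decay _ _ _) (eps ^+ 2) (X / Lam) (k%:R : R) => u v w z; clear.
  by rewrite -(mulrA 256) (mulrC w); move: (v * w) (z * v) => r s; lra.
have [S [prog [S0 hc hp]]] := static_estimator n h p12 b0 e0 k0 hdec.
exists S, prog; split => //.
  move=> B s; rewrite hc natrD !natrM natrD.
  have hk : h%:R * k%:R <= 4 * Lam * (256 * (X / Lam) + 1) :> R.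
    apply: ler_pM; rewrite ?ler0n//; apply: le_trans h2 _; move: L1; clear; lra.
  have XL : 4 * Lam * (256 * (X / Lam) + 1) = 1024 * X + 4 * Lam.
    by field; rewrite gt_eqF.
  rewrite XL in hk; rewrite -(mulrA 2).
  move: hk h2 g2 L1 X0; move: (h%:R * k%:R) => hk; move: (h%:R : R) (g%:R : R) => hh gg.
  by clear; move: X => Y; lra.
move=> B hB; apply: le_trans (hp B hB) _.
have hh := half_exp_le (ltW L0) h1.
have h3 : 2^-1 ^+ (h + g) <= 2^-1 ^+ h :> R.
  by apply: ler_wiXn2l; rewrite ?invr_ge0 ?invf_le1 ?ler1n ?leq_addr.
have h4 : 4^-1 ^+ h <= 2^-1 ^+ h :> R.
  by apply: lerXn2r; rewrite ?nnegrE ?invr_ge0 ?lef_pV2 ?posrE// ler_nat.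
move: hh h3 h4; move: (2^-1 ^+ (h + g)) (4^-1 ^+ h) (2^-1 ^+ h) (expR _) => u v w z; clear; lra.
Qed.

End SampleSizes.

(** * Translation into online algorithms *)

Section OnlineRun.
Variables (R : realType) (n m : nat).

Section OneStep.
Variables (i : nat) (o : 'I_m) (hoi : (o <= i)%N).
Variable prev : option {j : 'I_m | (j <= i)%N}.

(** A product with a difference of two matrices costs two queries, both allowed at time [i] as
    neither index exceeds [i]. *)
Fixpoint run_qtree (t : qtree R n) (k : R -> online_alg R n m i) : online_alg R n m i :=
  match t with
  | QRet r => k r
  | QAsk x c =>
      Query x hoi (fun y =>
        if prev is Some jh then
          Query x (proj2_sig jh) (fun y' => run_qtree (c (y - y')) k)
        else run_qtree (c y) k)
  end.

Definition step_mx (A : 'I_m -> 'M[R]_n) : 'M[R]_n :=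
  if prev is Some jh then A o - A (proj1_sig jh) else A o.

Lemma outputs_run A t k :
  outputs A (run_qtree t k) = outputs A (k (qeval (step_mx A) t)).
Proof.
rewrite /step_mx; elim: t => [//|x c IH] /=; case: prev IH => [jh|] IH /=.
  by rewrite mulmxBl; exact: IH.
exact: IH.
Qed.

Lemma num_queries_run A t k :
  (num_queries A (run_qtree t k) <=
   2 * qcost (step_mx A) t + num_queries A (k (qeval (step_mx A) t)))%N.
Proof.
rewrite /step_mx; elim: t => [r|x c IH] /=; first by rewrite muln0.
case: prev IH => [jh|] IH /=.
  rewrite mulmxBl; have := IH (A o *m x - A (proj1_sig jh) *m x).
  by move: (num_queries _ (run_qtree _ _)) => u; move: (qcost _ _) (num_queries _ _) => v w; lia.
have := IH (A o *m x).
by move: (num_queries _ (run_qtree _ _)) => u; move: (qcost _ _) (num_queries _ _) => v w; lia.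
Qed.

End OneStep.

Variable par : nat -> option nat.
Hypothesis par_lt : forall i j, par i = Some j -> (j < i)%N.

(** Extension by zero, so that index arithmetic takes place in [nat]. *)
Definition ext (A : 'I_m -> 'M[R]_n) (i : nat) : 'M[R]_n :=
  if insub i is Some o then A o else 0.

Definition incr (A : 'I_m -> 'M[R]_n) (i : nat) : 'M[R]_n :=
  if par i is Some j then ext A i - ext A j else ext A i.

Lemma ext_ord A (o : 'I_m) : ext A o = A o.
Proof. by rewrite /ext valK. Qed.

Lemma run_incr (i : nat) (t : qtree R n) (k : R -> online_alg R n m i) : (i < m)%N ->
  exists a : online_alg R n m i, forall A,
    outputs A a = outputs A (k (qeval (incr A i) t)) /\
    (num_queries A a <=
      2 * qcost (incr A i) t + num_queries A (k (qeval (incr A i) t)))%N.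
Proof.
move=> im; pose o := Ordinal im; have hoi : (o <= i)%N by [].
case parE : (par i) => [j|].
  have ji := par_lt parE; pose oj := Ordinal (ltn_trans ji im).
  pose jh : {j : 'I_m | (j <= i)%N} := exist (fun j : 'I_m => (j <= i)%N) oj (ltnW ji).
  exists (run_qtree hoi (Some jh) t k) => A.
  have -> : incr A i = step_mx o (Some jh) A.
    by rewrite /incr parE /= -(ext_ord A o) -(ext_ord A oj).
  by split; [exact: outputs_run|exact: num_queries_run].
exists (run_qtree hoi None t k) => A.
have -> : incr A i = step_mx o (@None {j : 'I_m | (j <= i)%N}) A.
  by rewrite /incr parE /= -(ext_ord A o).
by split; [exact: outputs_run|exact: num_queries_run].
Qed.

Variable prog : nat -> qtree R n.
Variable comb : nat -> seq R -> R.

Lemma halt_at (i : nat) : i = m -> exists a : online_alg R n m i,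
  forall A, outputs A a = [::] /\ num_queries A a = 0%N.
Proof. by move=> ->; exists (Halt R n m). Qed.

(** The argument of [a] is the list of results of earlier times, the only state carried along;
    [comb] turns it into the emitted estimate. Induction is on the number [d] of remaining times. *)
Lemma online_build (d i : nat) : (i + d = m)%N ->
  exists a : seq R -> online_alg R n m i, forall A,
    let e j := qeval (incr A j) (prog j) in
    outputs A (a (map e (iota 0 i))) =
      map (fun j => comb j (map e (iota 0 j.+1))) (iota i d) /\
    (num_queries A (a (map e (iota 0 i))) <=
      \sum_(j <- iota i d) 2 * qcost (incr A j) (prog j))%N.
Proof.
elim: d i => [|d IHd] i.
  rewrite addn0 => /halt_at[a ha]; exists (fun=> a) => A e.
  by have [-> ->] := ha A; rewrite big_nil.
move=> idm; have im : (i < m)%N by rewrite -idm -addSnnS leq_addr.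
have [a' ha'] := IHd i.+1 (etrans (addSnnS i d) idm).
have ex_a (h : seq R) := @run_incr i (prog i)
  (fun r => Emit (comb i (rcons h r)) (a' (rcons h r))) im.
have [a ha] := choice ex_a; exists a => A e.
have [-> hq] := ha (map e (iota 0 i)) A.
have eE : rcons (map e (iota 0 i)) (e i) = map e (iota 0 i.+1).
  by rewrite -[in RHS]addn1 iotaD map_cat/= cats1.
have [hout hnum] := ha' A; split=> /=.
  by rewrite -/(e i) eE hout.
rewrite big_cons; apply: leq_trans hq _; rewrite leq_add2l/= -/(e i) eE.
exact: hnum.
Qed.

End OnlineRun.

(** * Dyadic chains of times, as in a Fenwick tree *)

Section Fenwick.
Variable L : nat.

(** Time 0 has the top level [L], so its matrix is estimated from scratch. *)
Definition lev (i : nat) : nat := if i is 0 then L else minn (logn 2 i) L.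

(** Clears the lowest set bit of [i]; a chain ends at level [L]. *)
Definition par (i : nat) : option nat :=
  if (lev i < L)%N then Some (i - 2 ^ lev i)%N else None.

Lemma lev_le i : (lev i <= L)%N.
Proof. by case: i => //= i; exact: geq_minr. Qed.

Lemma lev_dvd i : (2 ^ lev i %| i)%N.
Proof.
case: i => [|i]; first exact: dvdn0.
by rewrite pfactor_dvdn// geq_minl.
Qed.

Lemma lev_lt_pow_le i : (lev i < L)%N -> (2 ^ lev i <= i)%N.
Proof. by case: i => [|i]; rewrite ?ltnn// => _; apply: dvdn_leq (lev_dvd _). Qed.

Lemma par_lt i j : par i = Some j -> (j < i)%N.
Proof.
rewrite /par; case: ifP => // hi [<-].
have := lev_lt_pow_le hi; have : (0 < 2 ^ lev i)%N by rewrite expn_gt0.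
by move: (2 ^ lev i)%N => u; lia.
Qed.

(** Below the cap, [i = q * 2^v] with [q] odd, and the parent [(q - 1) * 2^v] is divisible by
    [2^(v + 1)]. *)
Lemma lev_par i j : par i = Some j -> (lev i < lev j)%N.
Proof.
rewrite /par; case: ifP => // hi [<-]; set j' := (i - _)%N.
have [->//|j0] := posnP j'.
have i0 : (0 < i)%N by rewrite lt0n; apply: contraTneq hi => ->; rewrite /= ltnn.
have li : lev i = logn 2 i.
  by move: hi; case: (i) i0 => //= k _; rewrite gtn_min ltnn orbF => /ltnW/minn_idPl.
have lj : lev j' = minn (logn 2 j') L by case: (j') j0.
rewrite lj leq_min hi andbT -pfactor_dvdn//.
have [q iE] := dvdnP (lev_dvd i).
have qodd : odd q.
  apply: contraT => /negbTE qe; have : (2 ^ (lev i).+1 %| i)%N.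
    by rewrite {2}iE expnS dvdn_pmul2r ?expn_gt0// dvdn2 qe.
  by rewrite pfactor_dvdn// li ltnn.
have -> : j' = (q.-1 * 2 ^ lev i)%N.
  by rewrite /j' {1}iE -{2}[(2 ^ _)%N]mul1n -mulnBl subn1.
rewrite expnS dvdn_pmul2r ?expn_gt0// dvdn2.
by case: (q) qodd.
Qed.

(* [f] is fuel: [lev] increases strictly along [par], so [L.+1] suffices. *)
Fixpoint fen (R : nmodType) (e : nat -> R) (f : nat) (i : nat) : R :=
  if f is f'.+1 then e i + (if par i is Some j then fen e f' j else 0) else 0.

Lemma eq_fen (R : nmodType) (e e' : nat -> R) f i :
  (forall j, (j <= i)%N -> e j = e' j) -> fen e f i = fen e' f i.
Proof.
elim: f i => //= f IHf i ee'; rewrite ee'//; congr (_ + _).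
case parE : (par i) => [j|//]; apply: IHf => k kj; apply: ee'.
exact: leq_trans kj (ltnW (par_lt parE)).
Qed.

(** A positive time of level [a] is a multiple of [2^a], and at most [m / 2^a] of the positive times
    below [m] are; the extra 1 counts time 0. *)
Lemma sum_lev_le (R : realType) (m : nat) (f : nat -> R) : (forall a, 0 <= f a) ->
  \sum_(j <- iota 0 m) f (lev j) <=
  \sum_(a < L) m%:R / 2 ^+ a * f a + (m%:R / 2 ^+ L + 1) * f L.
Proof.
move=> f0; have cnt a : \sum_(j <- iota 0 m) ((0 < j) && (2 ^ a %| j))%N%:R <= m%:R / 2 ^+ a :> R.
  rewrite ler_pdivlMr ?exprn_gt0// -natr_sum -natrX -natrM ler_nat.
  case: m => [|m]; first by rewrite big_nil.
  rewrite /= big_cons/= add0n.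
  have -> : (\sum_(j <- iota 1 m) ((0 < j) && (2 ^ a %| j)) = m %/ 2 ^ a)%N.
    rewrite divn_count_dvd /index_iota subn1/= big_seq [in RHS]big_seq.
    by apply: eq_bigr => j; rewrite mem_iota => /andP[-> _].
  exact: leq_trans (leq_trunc_div _ _) (leqnSn m).
have fE j : f (lev j) <= \sum_(a < L) ((0 < j) && (2 ^ a %| j))%N%:R * f a
    + ((0 < j) && (2 ^ L %| j))%N%:R * f L + (j == 0)%N%:R * f L.
  have s0 : 0 <= \sum_(a < L) ((0 < j) && (2 ^ a %| j))%N%:R * f a.
    by apply: sumr_ge0 => a _; rewrite mulr_ge0.
  have [->|jn0] := eqVneq j 0%N.
    rewrite [X in _ <= _ + X]mul1r lerDr addr_ge0 ?mulr_ge0//.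
    by apply: sumr_ge0 => a _; rewrite mulr_ge0.
  rewrite mul0r addr0; have j0 : (0 < j)%N by rewrite lt0n.
  rewrite j0 in s0 *.
  have := lev_le j; rewrite leq_eqVlt => /predU1P[levj|levj].
    have dL : (2 ^ L %| j)%N by have := lev_dvd j; rewrite levj.
    by rewrite levj dL [X in _ <= _ + X]mul1r lerDr.
  apply: (@le_trans _ _ (\sum_(a < L) (true && (2 ^ a %| j))%N%:R * f a)).
    rewrite (bigD1 (Ordinal levj))//= lev_dvd mul1r lerDl.
    by apply: sumr_ge0 => a _; rewrite mulr_ge0.
  by rewrite lerDl mulr_ge0.
apply: le_trans (ler_sum _ (fun j _ => fE j)) _.
rewrite !big_split/= exchange_big/= -addrA; apply: lerD.
  by apply: ler_sum => a _; rewrite -mulr_suml ler_wpM2r.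
rewrite -!mulr_suml mulrDl; apply: lerD; first by rewrite ler_wpM2r.
rewrite ler_wpM2r//; case: m {cnt} => [|m]; first by rewrite big_nil.
rewrite /= big_cons/= big1_seq ?addr0// => j /andP[_]; rewrite mem_iota.
by case: j.
Qed.

End Fenwick.

(** * Shared seeds and their probability space *)

Section Seeds.
Variable R : realType.

(** The seed spaces of the levels are multiplied together; the projections preserve uniform laws,
    and [ok] is assumed stable under maps that do. *)
Lemma joint_seeds (n N : nat) (ok : nat -> forall S : finType, (S -> qtree R n) -> Prop) :
  (forall v (S T : finType) (prog : S -> qtree R n) (f : T -> S),
     (forall Q : pred S, pr R (Q \o f) = pr R Q) -> ok v S prog -> ok v T (prog \o f)) ->
  (forall v, exists (S : finType) (prog : S -> qtree R n),
     (0 < #|S|)%N /\ ok v S prog) ->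
  exists (T : finType) (prog : nat -> T -> qtree R n),
    (0 < #|T|)%N /\ forall v, (v < N)%N -> ok v T (prog v).
Proof.
move=> oktrans hex; elim: N => [|N [T [prog [T0 hT]]]].
  exists unit, (fun _ _ => QRet _ 0); split=> //; by rewrite card_unit.
have [S [progS [S0 hS]]] := hex N.
exists (T * S)%type, (fun v ts => if v == N then progS ts.2 else prog v ts.1).
split; first by rewrite card_prod muln_gt0 T0.
have pr1 (Q : pred T) : pr R (Q \o (fst : T * S -> T)) = pr R Q.
  by rewrite /pr avg_pair; apply: eq_avg => t; exact: (avg_const ((Q t)%:R : R) S0).
have pr2 (Q : pred S) : pr R (Q \o (snd : T * S -> S)) = pr R Q.
  by rewrite /pr avg_pair; exact: (avg_const (pr R Q) T0).
move=> v; rewrite ltnS leq_eqVlt => /predU1P[->|vN].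
  rewrite (_ : (fun ts : T * S => _) = progS \o snd); first exact: oktrans hS.
  by apply/funext => ts /=; rewrite eqxx.
rewrite (_ : (fun ts : T * S => _) = prog v \o fst); first exact: oktrans (hT v vN).
by apply/funext => ts /=; rewrite ltn_eqF.
Qed.

(** Normalised sum of the Dirac masses at [0, ..., N]. *)
Definition uniform_nat (N : nat) : set nat -> \bar R :=
  @mscale _ nat R (N.+1%:R^-1)%:nng (msum (fun k => \d_k) N.+1).

HB.instance Definition _ N := Measure.on (uniform_nat N).

Lemma uniform_natE N (X : set nat) :
  uniform_nat N X = (avg (fun k : 'I_N.+1 => (`[< X k >])%:R))%:E.
Proof.
rewrite /uniform_nat /mscale /msum /avg card_ord mulrC EFinM; congr (_ * _)%E.
rewrite -sumEFin; apply: eq_bigr => k _; rewrite /= diracE.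
by rewrite /in_mem /=.
Qed.

Lemma uniform_nat_setT N : uniform_nat N setT = 1%E.
Proof.
rewrite uniform_natE -[in RHS](avg_const (1 : R) (S := 'I_N.+1)) ?card_ord//.
by congr (_%:E); apply: eq_avg => k; rewrite asboolT.
Qed.

HB.instance Definition _ N := Measure_isProbability.Build _ _ _
  (uniform_nat N) (uniform_nat_setT N).

Lemma uniform_seed (S : finType) : (0 < #|S|)%N ->
  exists (P : probability nat R) (X : nat -> S),
    forall Q : pred S, P [set w | Q (X w)] = (pr R Q)%:E.
Proof.
move=> S0; have /card_gt0P[s0 _] := S0.
have cS : #|S| = #|S|.-1.+1 by rewrite prednK.
exists (uniform_nat #|S|.-1), (fun w => nth s0 (enum S) w) => Q.
apply: etrans (uniform_natE _ _) _.
rewrite /pr /avg card_ord -cS; congr (_ / _)%:E.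
rewrite -(big_mkord xpredT (fun k => (`[< Q (nth s0 (enum S) k) >])%:R : R)).
rewrite -[RHS]big_enum/= (big_nth s0) -cardE.
by apply: eq_bigr => k _; rewrite asboolb.
Qed.

End Seeds.

(** * Error and cost along the chains *)

Section DynamicTrace.
Variable R : realType.

Lemma ext_lt (n m i : nat) (A : 'I_m -> 'M[R]_n) (im : (i < m)%N) :
  ext A i = A (Ordinal im).
Proof. exact: (ext_ord A (Ordinal im)). Qed.

Lemma schatten_drift (n m k i : nat) (p alpha : R) (A : 'I_m -> 'M[R]_n) :
  1 <= p -> 0 < alpha ->
  (forall i j : 'I_m, nat_of_ord j = i.+1 -> schatten_norm p (A j - A i) <= alpha) ->
  (i + k.+1 < m)%N ->
  schatten_norm p (ext A (i + k.+1) - ext A i) <= k.+1%:R * alpha.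
Proof.
move=> p1 a0 hA; elim: k => [|k IHk] him.
  have im : (i < m)%N by apply: ltn_trans him; rewrite addn1.
  rewrite addn1 in him *; rewrite mul1r.
  by rewrite (ext_lt A him) (ext_lt A im); exact: hA.
have him' : (i + k.+1 < m)%N by apply: ltn_trans him; rewrite ltn_add2l.
have -> : ext A (i + k.+2) - ext A i =
    (ext A (i + k.+1) - ext A i) + (ext A (i + k.+2) - ext A (i + k.+1)).
  by rewrite [RHS]addrC addrA subrK.
rewrite -natr1 mulrDl mul1r; apply: schatten_norm_leD => //.
- by rewrite mulr_gt0.
- exact: IHk.
rewrite addnS in him *.
by rewrite (ext_lt A him) (ext_lt A him'); exact: hA.
Qed.

(** Levels increase strictly along a chain, so [c] with [L <= lev L i + c] bounds the number of
    further links; errors and failure probabilities add up over at most [c + 1] links. *)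
Lemma fen_error (L n m : nat) (T : finType) (e : nat -> T -> R) (A : 'I_m -> 'M[R]_n)
    (eps del : R) : 0 <= eps -> 0 <= del ->
  (forall j, (j < m)%N ->
     pr R (fun w => ~~ (`|e j w - \tr (incr (par L) A j)| <= eps)) <= del) ->
  forall c i f, (i < m)%N -> (L <= lev L i + c)%N -> (c < f)%N ->
  pr R (fun w => ~~ (`|fen L (e^~ w) f i - \tr (ext A i)| <= c.+1%:R * eps))
    <= c.+1%:R * del.
Proof.
move=> eps0 del0 he; elim=> [|c IHc] i f im hL cf; case: f cf => // f cf.
  have pN : par L i = None by rewrite /par ltnNge -[lev L i]addn0 hL.
  have := he i im; rewrite /incr pN !mul1r; apply: le_trans.
  by apply: pr_sub => w /=; rewrite pN addr0.
have [parE|pN] : (exists j, par L i = Some j) \/ par L i = None.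
  by case: (par L i) => [j|]; [left; exists j|right].
- have [j parEj] := parE; have ji := par_lt parEj; have lij := lev_par parEj.
  have jm := ltn_trans ji im.
  have hLj : (L <= lev L j + c)%N by move: hL lij; rewrite addnS -addSn; lia.
  have h1 := he i im; have h2 := IHc j f jm hLj cf.
  apply: (@le_trans _ _ (pr R (fun w => ~~ (`|e i w - \tr (incr (par L) A i)| <= eps)
      || ~~ (`|fen L (e^~ w) f j - \tr (ext A j)| <= c.+1%:R * eps)))); last first.
    apply: le_trans (prU _ _ _) _.
    by rewrite -[c.+2%:R]natr1 mulrDl mul1r addrC lerD.
  apply: pr_sub => w /=; rewrite parEj -negb_and; apply: contra => /andP[g1 g2].
  have -> : e i w + fen L (e^~ w) f j - \tr (ext A i) =
      (fen L (e^~ w) f j - \tr (ext A j)) + (e i w - \tr (incr (par L) A i)).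
    by rewrite /incr parEj linearB/=; ring.
  apply: le_trans (ler_normD _ _) _.
  by rewrite -[c.+2%:R]natr1 mulrDl mul1r lerD.
- have h1 : del <= c.+2%:R * del by rewrite ler_peMl// ler1n.
  apply: le_trans h1; have := he i im; rewrite /incr pN; apply: le_trans.
  apply: pr_sub => w /=; rewrite pN addr0; apply: contra => h; apply: le_trans h _.
  by rewrite ler_peMl// ler1n.
Qed.

(** An increment of level [v < L] spans [2^v] steps of size at most [alpha]; level [L] concerns a
    whole matrix, of norm at most 1. *)
Definition incr_radius (L : nat) (alpha : R) (v : nat) : R :=
  if (v < L)%N then alpha * 2 ^+ v else 1.

Lemma incr_schatten_le (L n m i : nat) (p alpha : R) (A : 'I_m -> 'M[R]_n) :
  1 <= p -> 0 < alpha -> (forall i, schatten_norm p (A i) <= 1) ->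
  (forall i j : 'I_m, nat_of_ord j = i.+1 -> schatten_norm p (A j - A i) <= alpha) ->
  (i < m)%N -> schatten_norm p (incr (par L) A i) <= incr_radius L alpha (lev L i).
Proof.
move=> p1 a0 hA1 hA im; rewrite /incr /par /incr_radius; case: ifP => hlev; last first.
  by rewrite (ext_lt A im).
have hle := lev_lt_pow_le hlev.
have := @schatten_drift n m (2 ^ lev L i).-1 (i - 2 ^ lev L i) p alpha A p1 a0 hA.
rewrite prednK ?expn_gt0// subnK// natrX mulrC; exact.
Qed.

(** Since [alpha * 2^a <= 1 <= p], the [m / 2^a] increments of level [a < L] cost at most
    [m alpha Y] together. Level [L] costs at most [(2 m alpha + 1) Y], as [2^(- L) <= 2 alpha]. The
    constant is [6 * 9], from [L + 2 <= 6 l] and [3^p <= 9]. *)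
Lemma total_cost_le (m L : nat) (p alpha eps Lam l : R) :
  1 <= p <= 2 -> 0 < alpha -> alpha * 2 ^+ L <= 1 -> 1 <= alpha * 2 ^+ L.+1 ->
  0 < eps -> 0 <= Lam -> L.+1%:R <= 3 * l ->
  \sum_(j <- iota 0 m)
     (incr_radius L alpha (lev L j) * Num.sqrt Lam / (eps / L.+1%:R)) `^ p <=
  54 * ((m%:R * alpha + 1) * l `^ (1 + p) * (Num.sqrt Lam / eps) `^ p).
Proof.
move=> /andP[p1 p2] a0 aL1 aL2 e0 L0 hl.
have s0 : 0 <= Num.sqrt Lam / eps by rewrite divr_ge0 ?sqrtr_ge0// ltW.
have l0 : 0 < l by rewrite -(pmulr_rgt0 _ (_ : 0 < 3))//; apply: lt_le_trans hl; rewrite ltr0n.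
pose X v := (incr_radius L alpha v * Num.sqrt Lam / (eps / L.+1%:R)) `^ p.
pose Y := (L.+1%:R * (Num.sqrt Lam / eps)) `^ p.
have Y0 : 0 <= Y by exact: powR_ge0.
have rad0 v : 0 <= incr_radius L alpha v.
  by rewrite /incr_radius; case: ifP => // _; rewrite mulr_ge0 ?exprn_ge0// ltW.
have XE v : X v = incr_radius L alpha v `^ p * Y.
  rewrite /X /Y -(powRM p (rad0 v) (mulr_ge0 (ler0n R L.+1) s0)); congr (_ `^ _).
  have : (L.+1%:R : R) != 0 by rewrite pnatr_eq0.
  by move: (L.+1%:R : R) (incr_radius _ _ _) => c r c0; field; rewrite c0 gt_eqF.
have XL : X L = Y by rewrite XE /incr_radius ltnn powR1 mul1r.
have Xa (a : 'I_L) : m%:R / 2 ^+ a * X a <= m%:R * alpha * Y.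
  rewrite XE mulrA ler_wpM2r//.
  have r1 : incr_radius L alpha a = alpha * 2 ^+ a by rewrite /incr_radius ltn_ord.
  have ra0 : 0 < alpha * 2 ^+ a by rewrite mulr_gt0 ?exprn_gt0.
  have hr : (alpha * 2 ^+ a) `^ p <= alpha * 2 ^+ a.
    apply: ge1r_powR => //; rewrite ra0/=; apply: le_trans aL1.
    by rewrite ler_wpM2l ?(ltW a0)// ler_weXn2l ?ler1n// ltnW.
  rewrite r1 -!mulrA ler_wpM2l//.
  rewrite mulrC ler_pdivrMr ?exprn_gt0//.
have inv2L : (2 ^+ L)^-1 <= 2 * alpha.
  rewrite -[leLHS]mul1r ler_pdivrMr ?exprn_gt0//; apply: le_trans aL2 _.
  by rewrite exprS mulrCA mulrA.
have m0 : 0 <= m%:R * alpha by rewrite mulr_ge0// ltW.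
apply: (@le_trans _ _ ((L.+1%:R + 1) * (m%:R * alpha + 1) * Y)).
  apply: le_trans (sum_lev_le L m (f := X) (fun a => powR_ge0 _ _)) _.
  apply: (@le_trans _ _ (\sum_(a < L) m%:R * alpha * Y + (2 * (m%:R * alpha) + 1) * Y)).
    apply: lerD; first by apply: ler_sum => a _.
    rewrite XL ler_wpM2r// lerD2r mulrCA ler_wpM2l//.
  rewrite sumr_const card_ord -[_ *+ L]mulr_natl -natr1 -subr_ge0.
  rewrite (_ : _ - _ = (L%:R + 1) * Y); last by ring.
  by rewrite mulr_ge0// addr_ge0.
have Yle : Y <= 9 * l `^ p * (Num.sqrt Lam / eps) `^ p.
  rewrite /Y powRM// ler_wpM2r ?powR_ge0//.
  apply: (@le_trans _ _ ((3 * l) `^ p)).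
    apply: ge0_ler_powR; rewrite ?nnegrE//; first by move: p1; clear; lra.
    by rewrite mulr_ge0// ltW.
  rewrite powRM ?(ltW l0)// ler_wpM2r ?powR_ge0//.
  have -> : 9 = 3 `^ 2%:R :> R by rewrite powR_mulrn//; ring.
  by apply: ler_powR => //; rewrite ler1n.
have Ll : L.+1%:R + 1 <= 6 * l.
  have h1 : 1 <= L.+1%:R :> R by rewrite ler1n.
  by move: h1 hl; move: (L.+1%:R : R) => u; clear; lra.
have lp : l `^ (1 + p) = l * l `^ p.
  by rewrite powRD ?(gt_eqF l0) ?implybT// powRr1 ?ltW.
apply: (@le_trans _ _ (6 * l * (m%:R * alpha + 1) *
    (9 * l `^ p * (Num.sqrt Lam / eps) `^ p))).
  apply: ler_pM => //; first by rewrite mulr_ge0// addr_ge0.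
  by rewrite ler_wpM2r// addr_ge0.
rewrite lp le_eqVlt; apply/orP; left; apply/eqP; ring.
Qed.

Lemma dyadic_depth (alpha : R) : 0 < alpha < 1 ->
  exists L : nat, [/\ alpha * 2 ^+ L <= 1, 1 <= alpha * 2 ^+ L.+1
                   & L.+1%:R <= 3 * Log (1 / alpha)].
Proof.
move=> /andP[a0 a1]; pose N := Num.truncn (1 / alpha).
have ia1 : 1 <= 1 / alpha by rewrite ler_pdivlMr// mul1r ltW.
have /andP[N1 N2] := Num.Theory.truncn_itv (le_trans ler01 ia1).
have N0 : (0 < N)%N by rewrite truncn_gt0.
have /andP[L1 L2] := trunc_log_bounds (isT : (1 < 2)%N) N0.
set L := trunc_log 2 N in L1 L2.
have hL1 : 2 ^+ L <= 1 / alpha by apply: le_trans N1; rewrite -natrX ler_nat.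
have hL2 : 1 / alpha <= 2 ^+ L.+1.
  by apply: le_trans (ltW N2) _; rewrite -natrX ler_nat.
exists L; split.
- by rewrite mulrC -ler_pdivlMr.
- by rewrite mulrC -ler_pdivrMr.
have : ln (2 ^+ L) <= ln (1 / alpha).
  by rewrite ler_ln ?posrE ?exprn_gt0// (lt_le_trans ltr01).
rewrite lnXn// -[_ *+ L]mulr_natl => hln.
have h1 : ln (1 / alpha) <= Log (1 / alpha) by rewrite /Log le_max lexx orbT.
have h2 : 1 <= Log (1 / alpha) by rewrite /Log le_max lexx.
have := ler_wpM2l (ler0n R L) (ln2_ge_half R).
move: hln h1 h2; rewrite -[L.+1%:R]natr1; move: (L%:R * ln 2) => u.
by move: (ln (1 / alpha)) (Log _) (L%:R : R) => v w z; clear; lra.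
Qed.

End DynamicTrace.

(** * Assembly of the online estimator and choice of its parameters *)

Theorem theoremB2 (R : realType) :
  exists C : R, 0 < C /\
    forall (n m : nat) (p alpha delta eps : R),
      1 <= p <= 2 -> 0 < alpha < 1 -> 0 < delta -> 0 < eps ->
      exists (d : measure_display) (T : measurableType d) (P : probability T R)
             (alg : T -> online_alg R n m 0),
        forall A : 'I_m -> 'M[R]_n,
          (forall i : 'I_m, schatten_norm p (A i) <= 1) ->
          (forall i j : 'I_m, nat_of_ord j = i.+1 ->
             schatten_norm p (A j - A i) <= alpha) ->
          (forall i : 'I_m,
             measurable_fun [set: T] (estimate alg A i) /\
             ((1 - delta)%:E <=
                P [set w | (`|estimate alg A i w - \tr (A i)| <= eps)%R])%E) /\
          (forall w : T,
             (num_queries A (alg w))%:R <= C * query_bound m p alpha delta eps).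
Proof.
have [K [K0 hstatic]] := static_queries R.
(* Factor 2 for products with differences, [K] for the static estimator, 54 for the sum over the
   levels. *)
exists (2 * K * 54); split; first by rewrite mulr_gt0 ?ltr0n// mulr_gt0.
move=> n m p alpha delta eps p12 a01 d0 e0.
have /andP[p1 _] := p12; have /andP[a0 a1] := a01.
have [L [aL1 aL2 Ll]] := dyadic_depth a01.
pose Lam := Log (1 / (alpha * delta)).
have L1 : 1 <= Lam by rewrite /Lam /Log le_max lexx.
have eL : expR (- Lam) <= alpha * delta.
  have ad0 : 0 < alpha * delta by rewrite mulr_gt0.
  rewrite -[leRHS]lnK ?posrE// ler_expR lerNl -lnV ?posrE// -div1r.
  by rewrite /Lam /Log le_max lexx orbT.
(* A chain has at most [L + 1] links; each gets an equal share of the error. *)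
have eps'0 : 0 < eps / L.+1%:R by rewrite divr_gt0// ltr0n.
pose X v := (incr_radius L alpha v * Num.sqrt Lam / (eps / L.+1%:R)) `^ p.
pose ok v (S : finType) (prog : S -> qtree R n) :=
  (forall B s, (qcost B (prog s))%:R <= K * (X v + Lam)) /\
  (forall B, schatten_norm p B <= incr_radius L alpha v ->
     pr R (fun s => ~~ (`|qeval B (prog s) - \tr B| <= eps / L.+1%:R)) <= expR (- Lam)).
have [S [prog [S0 hprog]]] : exists (T : finType) (prog : nat -> T -> qtree R n),
    (0 < #|T|)%N /\ forall v, (v < L.+1)%N -> ok v T (prog v).
  apply: joint_seeds => [v S T prog f hf [hc hp]|v].
    split=> [B s|B hB]; first exact: hc.
    apply: le_trans (hp B hB).
    by rewrite -(hf (fun s => ~~ (`|qeval B (prog s) - \tr B| <= eps / L.+1%:R))).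
  have r0 : 0 < incr_radius L alpha v.
    by rewrite /incr_radius; case: ifP => // _; rewrite mulr_gt0 ?exprn_gt0.
  have [S [prog [S0 hc hp]]] := hstatic n _ _ _ _ p12 r0 eps'0 L1.
  by exists S, prog; split.
have [P [seed hP]] := @uniform_seed R S S0.
pose comb j (es : seq R) := fen L (nth 0 es) L.+1 j.
have ex_a (s : S) := @online_build R n m (par L) (@par_lt L)
  (fun j => prog (lev L j) s) comb m 0 (add0n m).
have [a ha] := choice ex_a.
exists _, nat, P, (fun w => a (seed w) [::]) => A hA1 hA.
pose e j s := qeval (incr (par L) A j) (prog (lev L j) s).
have outE s (i : 'I_m) : nth 0 (outputs A (a s [::])) i = fen L (e^~ s) L.+1 i.
  have [hout _] := ha s A; rewrite (hout : outputs A (a s [::]) = _).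
  rewrite (nth_map 0%N) ?size_iota ?ltn_ord// nth_iota// add0n.
  apply: eq_fen => j ji; rewrite (nth_map 0%N) ?size_iota ?ltnS//.
  by rewrite nth_iota ?ltnS.
split=> [i|w].
  (* Every subset of [nat] is measurable. *)
  split; first by move=> _ Y _.
  pose good s := `|fen L (e^~ s) L.+1 i - \tr (A i)| <= eps.
  have -> : [set w | (`|estimate (fun w => a (seed w) [::]) A i w - \tr (A i)| <= eps)%R] =
      [set w | good (seed w)].
    by apply/funext => w; rewrite /= /estimate outE.
  rewrite hP lee_fin; have := prC R good S0.
  have herr := @fen_error R L n m S e A (eps / L.+1%:R) (expR (- Lam))
    (ltW eps'0) (expR_ge0 _).
  have : pr R (predC good) <= delta.
    apply: (@le_trans _ _ (L.+1%:R * expR (- Lam))).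
      apply: le_trans (herr _ L i L.+1 (ltn_ord i) (leq_addl _ _) (ltnSn L)).
        by apply: pr_sub => s; rewrite ext_ord [L.+1%:R * _]mulrC divfK ?pnatr_eq0.
      move=> j jm; have [_ hp] := hprog (lev L j) (lev_le L j).
      by apply: hp; exact: incr_schatten_le.
    (* The factor [alpha] in the failure rate of a link pays for the union bound: [L + 1 <= 2^L] and
       [alpha * 2^L <= 1]. *)
    apply: (@le_trans _ _ (2 ^+ L * (alpha * delta))).
      apply: ler_pM; rewrite ?ler0n ?expR_ge0//.
      by rewrite -natrX ler_nat ltn_expl.
    by rewrite mulrA ler_piMl ?(ltW d0)// mulrC.
  by move=> h1 h2; rewrite h2 in h1; move: h1; move: (pr R good) => u; clear; lra.
have [_ hq] := ha (seed w) A.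
apply: (@le_trans _ _ (\sum_(j <- iota 0 m) (2 * K) * (X (lev L j) + Lam))).
  apply: (@le_trans _ _ (\sum_(j <- iota 0 m)
      2 * qcost (incr (par L) A j) (prog (lev L j) (seed w)))%N%:R).
    by rewrite ler_nat; exact: hq.
  rewrite natr_sum; apply: ler_sum => j _; rewrite natrM -mulrA ler_wpM2l//.
  by have [hc _] := hprog (lev L j) (lev_le L j); exact: hc.
rewrite -mulr_sumr -[leRHS]mulrA; apply: ler_wpM2l; first by rewrite mulr_ge0// ltW.
have hcost := total_cost_le m p12 a0 aL1 aL2 e0 (le_trans ler01 L1) Ll.
rewrite big_split/= /query_bound mulrDr; apply: lerD; first exact: hcost.
rewrite big_const_seq count_predT size_iota iter_addr addr0 -[Lam *+ m]mulr_natl.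
by apply: ler_peMl; rewrite ?ler1n// mulr_ge0// (le_trans ler01 L1).
Qed.
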